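(* Let $\mathring h(r)=\sin r$ and let $M=(0,\pi)\times N$ carry the metrics $g_0=dr^2+\sin^2(r)\,\hat G$ and $g=dr^2+G(r)$ described in the context. If the limits $\mathcal M(0)$ and $\mathcal M(\pi)$ of the relative radial mass $\mathcal M(r)$ at $0$ and $\pi$ exist (as real numbers) and $\sin^2(r)\,(R_{rr}-(n-1))\in L^1(M,dr\,d\mu_{\hat{G}})$, then $$\mathcal M(\pi)-\mathcal M(0)\ \geq\ \int_M \big(R_{rr}-(n-1)\big)\sin^2(r)\,dr\,d\mu_{\hat{G}},$$ with equality if and only if $g$ is a warped product in the sense that $G(r)=\sin^2(r)\widetilde{G}$ for some fixed (independent of $r$) Riemannian metric $\widetilde{G}$ on $N$. Moreover, if $g$ is asymptotic to $g_0$ at some $r_0\in[0,\pi]$, then equality occurs if and only if $g=g_0$.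
   Context: Let $n\geq 2$, let $N$ be a compact $(n-1)$-dimensional smooth manifold (with or without boundary), and let $r$ be the coordinate on the interval factor of $M$. All objects are assumed $C^\infty$. $\hat{G}$ is a fixed Riemannian metric on $N$, with Riemannian measure $\mu_{\hat G}$; $\mathring G(r)=\mathring h^2(r)\hat G$; and $G(r)$ is a family of Riemannian metrics on $N$, so that $g=dr^2+G(r)$ is a Riemannian metric on $M$. Let $H$ and $\mathring H$ be the mean curvatures (traces of the Weingarten maps with respect to $\partial_r$) of $N(r)=\{r\}\times N$ relative to $g$ and $g_0$: $H=\frac12\operatorname{Tr}(G^{-1}\partial_rG)$ and $\mathring H=(n-1)\mathring h'/\mathring h$. The relative radial mass is $\mathcal M(r)=\int_N \mathring{h}^{2}(\mathring{H}-H)\,d\mu_{\hat G}$. $R_{rr}$ denotes the Ricci curvature of $g$ in the $(\partial_r,\partial_r)$ direction. $g$ is said to be asymptotic to $g_0$ at a point $r_0$ of the closure of the interval if $\|G-\mathring G\|_{\mathring G}=o(1)$ as $r\to r_0$, uniformly on $N$ (pointwise norm of tensors on $N$ with respect to $\mathring G(r)$); for $r_0$ in the open interval this means that the two metrics coincide on $N(r_0)$. *)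

(* Defs.v *)
From mathcomp Require Import all_boot all_order all_algebra.
From mathcomp Require Import all_classical all_reals all_analysis.

Set Implicit Arguments.
Unset Strict Implicit.
Unset Printing Implicit Defensive.

Import Order.TTheory GRing.Theory Num.Theory.
Import numFieldNormedType.Exports.

Local Open Scope classical_set_scope.
Local Open Scope ring_scope.

Section Calculus.
Context {R : realType} {k : nat}.
Implicit Types (V D : set 'rV[R]_k) (f : 'rV[R]_k -> R).

Definition evec (i : 'I_k) : 'rV[R]_k := delta_mx 0 i.

(* For V open. *)
Fixpoint Cm_on (m : nat) V f : Prop :=
  (forall x, V x -> {for x, continuous f}) /\
  match m with
  | 0 => True
  | m'.+1 => forall i, (forall x, V x -> derivable f x (evec i)) /\
                       Cm_on m' V (fun x => 'D_(evec i) f x)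
  end.

(* For D arbitrary, f is smooth on D when it extends, locally around every
   point of D, to a smooth function on an open subset of R^k. *)
Definition smooth_on D f : Prop :=
  forall x, D x -> exists V (F : 'rV[R]_k -> R),
    [/\ open V, V x, forall m, Cm_on m V F &
        forall y, V y -> D y -> F y = f y].

(* The limit of the difference quotient is taken inside D: on a half-space this
   is the one-sided derivative in the normal direction at boundary points. *)
Definition pderiv D (i : 'I_k) f (x : 'rV[R]_k) : R :=
  lim ((fun t : R => t^-1 * (f (x + t *: evec i) - f x))
         @ within [set t | D (x + t *: evec i)] 0^').

Definition christoffel D (g : 'rV[R]_k -> 'M[R]_k) (l i j : 'I_k)
    (x : 'rV[R]_k) : R :=
  2^-1 * \sum_(m < k) invmx (g x) l m *
    (pderiv D i (fun y => g y j m) x + pderiv D j (fun y => g y i m) x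
     - pderiv D m (fun y => g y i j) x).

(* R_ij = d_l G^l_ij - d_j G^l_il + G^l_lm G^m_ij - G^l_jm G^m_il, the sign for
   which the round unit sphere of dimension n has Ric = (n - 1) g. *)
Definition ricci D (g : 'rV[R]_k -> 'M[R]_k) (i j : 'I_k) (x : 'rV[R]_k) : R :=
  let C := christoffel D g in
  \sum_(l < k) (pderiv D l (C l i j) x - pderiv D j (C l i l) x
    + \sum_(m < k) (C l l m x * C m i j x - C l j m x * C m i l x)).

End Calculus.

(* Iterated Lebesgue integral over R^d; by Tonelli this is the integral against
   d-dimensional Lebesgue measure for nonnegative Borel functions. *)
Fixpoint lebesgue_iint {R : realType} (d : nat) :
    ('rV[R]_d -> \bar R) -> \bar R :=
  match d return ('rV[R]_d -> \bar R) -> \bar R with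
  | 0 => fun f => f 0
  | d'.+1 => fun f =>
      (\int[lebesgue_measure]_(t in [set: R])
         lebesgue_iint (fun y : 'rV[R]_d' => f (row_mx (t%:M : 'M[R]_1) y)))%E
  end.

(* R^d restricted to a nonnegative 0-th coordinate (no constraint if d = 0). *)
Definition halfspace (R : realType) (d : nat) : set 'rV[R]_d :=
  [set x | forall i : 'I_d, val i = 0%N -> 0 <= x 0 i].
Arguments halfspace : clear implicits.

Record local_chart (R : realType) (T : topologicalType) (d : nat) := LocalChart {
  cdom : set T ;
  cmap : T -> 'rV[R]_d ;
  cinv : 'rV[R]_d -> T ;
  cdom_open : open cdom ;
  cimg_open : exists2 O : set 'rV[R]_d,
    open O & cmap @` cdom = O `&` halfspace R d ;
  cmapK : forall p, cdom p -> cinv (cmap p) = p ;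
  cmap_continuous : {within cdom, continuous cmap} ;
  cinv_continuous : {within cmap @` cdom, continuous cinv} }.

Definition cimg {R : realType} {T : topologicalType} {d : nat}
  (c : local_chart R T d) : set 'rV[R]_d := cmap c @` cdom c.

(* [chart_at] selects a chart around each point; it only serves to evaluate
   quantities that do not depend on the chart. *)
Record manifold (R : realType) (d : nat) := Manifold {
  carrier :> ptopologicalType ;
  atlas : Type ;
  chart : atlas -> local_chart R carrier d ;
  chart_at : carrier -> atlas ;
  chart_atP : forall p, cdom (chart (chart_at p)) p ;
  manifold_hausdorff : hausdorff_space carrier ;
  manifold_second_countable : @second_countable carrier ;
  transition_smooth : forall (c c' : atlas) (j : 'I_d),
    smooth_on (cmap (chart c) @` (cdom (chart c) `&` cdom (chart c')))
      (fun x => cmap (chart c') (cinv (chart c) x) 0 j) }.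

Notation borel N := (g_sigma_algebraType (@open N)).

(* A covariant 2-tensor field is given by its matrix of components in each chart
   of the atlas; only the values at points of the chart domain are relevant. *)
Definition tensor2 {R : realType} {d : nat} (N : manifold R d) : Type :=
  atlas N -> N -> 'M[R]_d.

Section Metrics.
Context {R : realType} {d : nat}.
Variable N : manifold R d.

(* Entry (i, j) is d x'_j / d x_i, for x and x' the coordinates of c and c'. *)
Definition transition_jacobian (c c' : atlas N) (p : N) : 'M[R]_d :=
  \matrix_(i, j)
    pderiv (cmap (chart c) @` (cdom (chart c) `&` cdom (chart c'))) i
      (fun x => cmap (chart c') (cinv (chart c) x) 0 j) (cmap (chart c) p).

Definition is_tensor (S : tensor2 N) : Prop :=
  forall c c' p, cdom (chart c) p -> cdom (chart c') p ->
    let J := transition_jacobian c c' p in S c p = J *m S c' p *m J^T.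

Definition is_riemannian (S : tensor2 N) : Prop :=
  [/\ is_tensor S,
      forall c p, cdom (chart c) p -> (S c p)^T = S c p,
      forall c p (v : 'rV[R]_d), cdom (chart c) p -> v != 0 ->
        0 < (v *m S c p *m v^T) 0 0 &
      forall c i j, smooth_on (cimg (chart c))
        (fun x => S c (cinv (chart c) x) i j)].

(* The measure with density sqrt(det S) in every chart, which determines it. *)
Definition is_riemannian_measure (S : tensor2 N) (mu : set (borel N) -> \bar R) :
    Prop :=
  forall (c : atlas N) (A : set (borel N)), measurable A -> A `<=` cdom (chart c) ->
    mu A = lebesgue_iint (fun x : 'rV[R]_d =>
      (\1_(cmap (chart c) @` A) x
         * Num.sqrt (\det (S c (cinv (chart c) x))))%:E).

(* sqrt(g^ik g^jl T_ij T_kl) *)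
Definition tensor_norm (g T : 'M[R]_d) : R :=
  Num.sqrt (\tr (invmx g *m T *m invmx g *m T^T)).

Implicit Types (a b r : R) (h : R -> R) (S : tensor2 N) (G : R -> tensor2 N).

(* In the chart of ]a, b[ x N induced by c, with coordinates (r, x). *)
Definition cyl_dom a b (c : atlas N) : set 'rV[R]_(1 + d) :=
  [set z | a < lsubmx z 0 0 < b /\ cimg (chart c) (rsubmx z)].

Definition cyl_metric G (c : atlas N) (z : 'rV[R]_(1 + d)) : 'M[R]_(1 + d) :=
  block_mx 1%:M 0 0 (G (lsubmx z 0 0) c (cinv (chart c) (rsubmx z))).

Definition is_cyl_metric a b G : Prop :=
  (forall r, a < r < b -> is_riemannian (G r)) /\
  (forall c i j, smooth_on (cyl_dom a b c) (fun z => cyl_metric G c z i j)).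

Definition radial_ricci a b G r (p : N) : R :=
  let c := chart_at p in
  let i0 : 'I_(1 + d) := lshift d ord0 in
  ricci (cyl_dom a b c) (cyl_metric G c) i0 i0
    (row_mx (r%:M : 'M[R]_1) (cmap (chart c) p)).

Definition weingarten G r (c : atlas N) (p : N) : 'M[R]_d :=
  2^-1 *: (invmx (G r c p)
             *m \matrix_(i, j) derive1 (fun s : R => G s c p i j) r).

Definition mean_curvature G r (p : N) : R :=
  \tr (weingarten G r (chart_at p) p).

Definition warped h S : R -> tensor2 N := fun r c p => h r ^+ 2 *: S c p.

Definition eq_family a b G G' : Prop :=
  forall r c p, a < r < b -> cdom (chart c) p -> G r c p = G' r c p.

Definition is_warped a b h G : Prop :=
  exists2 S, is_riemannian S & eq_family a b G (warped h S).

Definition radial_mass (mu : {measure set (borel N) -> \bar R}) h S G r : R :=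
  \int[mu]_(p in [set: borel N])
    (h r ^+ 2 * (mean_curvature (warped h S) r p - mean_curvature G r p)).

(* The filter is the trace on ]a, b[ of the neighbourhoods of r0, so it is
   one-sided at the end points, and for r0 inside it forces G r0 = G' r0. *)
Definition asymptotic_at a b G G' (r0 : R) : Prop :=
  forall e : R, 0 < e -> \forall r \near within `]a, b[ (nbhs r0),
    forall p : N, let c := chart_at p in
      tensor_norm (G' r c p) (G r c p - G' r c p) < e.

End Metrics.

(* Main.v *)
Require Import Defs.
From mathcomp Require Import finmap all_boot all_order all_algebra.
From mathcomp Require Import all_classical all_reals all_analysis.
From mathcomp Require Import ring lra measurable_realfun.

(** Fix p in N.  Let W be the Weingarten map of the slices {r} x N, let H be its
    trace, and put d = n - 1.  The mass at r is the integral over N of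

      u = sin^2 r (d cot r - H) = d sin r cos r - sin^2 r H   (radial_flux).

    The Riccati equation R_rr = - H' - tr W^2 turns the r-derivative of u into

      u' = (R_rr - d) sin^2 r + tr ((sin r W - cos r)^2)

    (radial_flux_derive).  The last term is called the excess.  As W is
    self-adjoint for G, the excess is the squared norm of a symmetric tensor
    (posdef_trace); hence it is nonnegative, and it vanishes exactly when
    sin r G' = 2 cos r G.  The curves that satisfy this equation for all r are the
    multiples of sin^2 r by a constant metric (excess_eq0_warped).

    Integrating over [s, t] x N, and letting s decrease to 0 and t increase to pi,
    the difference of the two sides of the inequality becomes the limit of the
    integrals over N of the excess integrated from s to t (defect_segment).  These
    integrals are nonnegative and grow with [s, t], so the inequality follows, and
    in the case of equality all of them vanish: the excess is zero for almost every
    p.  It is continuous in p and mu is positive on nonempty open sets, so it is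
    zero everywhere (mass_eq_excess0).  This characterizes warped products.  For two
    products warped by the same function, the relative norm of their difference
    does not depend on r; if it tends to 0 at one r0, the products are equal
    (asymptotic_warped_eq).

    Three facts connect this computation with the metrics.  In a chart of the
    cylinder the Christoffel symbols that enter R_rr are those of W, and all the
    others vanish (ricci_rr).  A change of chart conjugates W, so u and the excess
    are well-defined functions on N, and they are continuous (radial_flux_continuous,
    radial_excess_continuous).  Finally mu is finite on the compact N and positive
    on open sets, because in a chart it can be compared from both sides with a
    multiple of Lebesgue measure on a small cube (riemannian_measure_finite,
    riemannian_measure_open_gt0). *)

Import Order.TTheory GRing.Theory Num.Theory.
Import numFieldNormedType.Exports.

Local Open Scope classical_set_scope.
Local Open Scope ring_scope.

(** * Positive definite matrices *)

Definition posdef {R : realType} {d : nat} (A : 'M[R]_d) : Prop :=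
  A^T = A /\ forall v : 'rV[R]_d, v != 0 -> 0 < (v *m A *m v^T) 0 0.

(** Induction on the dimension: once the first row and column have been split
    off, the Schur complement is again positive definite. *)
Lemma posdef_factor {R : realType} {d : nat} (A : 'M[R]_d) :
  posdef A -> exists2 C : 'M[R]_d, C \in unitmx & A = C *m C^T.
Proof.
elim: d A => [|d IH] A [sA pA].
  by exists 1%:M; [exact: unitmx1 | apply/matrixP => -[]].
have [a [b [D defA]]] : exists (a : R) (b : 'rV[R]_d) (D : 'M[R]_d),
    A = block_mx (a%:M : 'M[R]_1) b b^T D.
  exists (ulsubmx (A : 'M[R]_(1 + d)) 0 0), (ursubmx (A : 'M[R]_(1 + d))),
    (drsubmx (A : 'M[R]_(1 + d))).
  rewrite -[LHS](@submxK _ 1 d 1 d) -mx11_scalar.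
  by rewrite trmx_ursub sA.
have pA' (v : 'rV[R]_(1 + d)) : v != 0 ->
    0 < (v *m block_mx (a%:M : 'M[R]_1) b b^T D *m v^T) 0 0.
  by rewrite -defA; exact: pA.
have a_gt0 : 0 < a.
  have v0 : row_mx (1 : 'M[R]_1) (0 : 'rV[R]_d) != 0.
    by rewrite -[X in _ != X]row_mx0; apply/eqP => /eq_row_mx[] /eqP; rewrite oner_eq0.
  have := pA' _ v0; rewrite tr_row_mx mul_row_block trmx0 mul_row_col.
  by rewrite !mul0mx !mulmx0 !addr0 trmx1 mul1mx mulmx1 mxE eqxx mulr1n.
have a0 : a != 0 by rewrite gt_eqF.
have sD : D^T = D.
  by move: sA; rewrite defA (@tr_block_mx _ 1 d 1 d) => /(@eq_block_mx _ 1 d 1 d)[].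
have [|C' C'u defC'] := IH (D - a^-1 *: (b^T *m b)).
  split; first by rewrite linearB/= linearZ/= trmx_mul trmxK sD.
  move=> v v0; set t := - a^-1 * (v *m b^T) 0 0.
  (* The vector (t, v) minimizes the quadratic form of A among the vectors (., v);
     the minimum is the value at v of the Schur complement. *)
  have w0 : row_mx (t%:M : 'M[R]_1) v != 0.
    by rewrite -[X in _ != X]row_mx0; apply: contra v0 => /eqP/eq_row_mx[_ ->].
  have := pA' _ w0; rewrite tr_row_mx mul_row_block mul_row_col.
  have vb : v *m b^T = ((v *m b^T) 0 0)%:M by rewrite [LHS]mx11_scalar.
  have bv : b *m v^T = ((v *m b^T) 0 0)%:M.
    by rewrite -[in LHS](trmxK b) -trmx_mul {1}vb tr_scalar_mx.
  have -> : (t%:M *m a%:M + v *m b^T : 'M[R]_1) = 0.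
    rewrite vb -scalar_mxM -raddfD/= /t mulrAC mulNr mulVf// mulN1r addNr.
    exact: raddf0.
  rewrite mul0mx add0r mulmxBr mulmxBl -scalemxAr -scalemxAl mulmxA vb.
  rewrite mulmxDl !mul_scalar_mx -!scalemxAl !bv.
  move: (v *m D *m v^T) => X; rewrite /t; move: ((v *m b^T) 0 0) => y.
  rewrite !mxE !eqxx !mulr1n => h.
  by have -> : X 0 0 - a^-1 * (y * y) = - a^-1 * y * y + X 0 0 by ring.
pose s := Num.sqrt a.
have s0 : s != 0 by rewrite gt_eqF// sqrtr_gt0.
have ss : s * s = a by rewrite -expr2 sqr_sqrtr// ltW.
exists (block_mx (s%:M : 'M[R]_1) 0 (s^-1 *: b^T) C' : 'M[R]_(1 + d)).
  rewrite unitmxE (@det_lblock _ 1 d) det_scalar1 unitrM unitfE s0.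
  by rewrite -unitmxE.
rewrite defA (@tr_block_mx _ 1 d 1 d) (@mulmx_block _ 1 d 1 d 1 d).
rewrite tr_scalar_mx -scalar_mxM ss trmx0 !mulmx0 !mul0mx addr0 ?add0r.
rewrite linearZ/= trmxK mul_scalar_mx scalerA divff// scale1r addr0.
rewrite mul_mx_scalar scalerA divff// scale1r -scalemxAl -scalemxAr scalerA.
by rewrite -invfM ss -defC' addr0 addrCA subrr addr0.
Qed.

Lemma posdef_unit {R : realType} {d : nat} (A : 'M[R]_d) :
  posdef A -> A \in unitmx.
Proof.
by move=> /posdef_factor[C uC ->]; rewrite unitmx_mul unitmx_tr uC.
Qed.

Lemma mxtrace_mul_tr {R : realType} {d : nat} (X : 'M[R]_d) :
  \tr (X *m X^T) = \sum_i \sum_j X i j ^+ 2.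
Proof.
apply: eq_bigr => i _; rewrite mxE; apply: eq_bigr => j _.
by rewrite mxE expr2.
Qed.

(** With g = C C^T the trace is that of X X^T for X = C^-1 T C^-T, that is,
    the sum of the squares of the entries of X.  This is the squared norm of the
    2-tensor T with respect to g. *)
Lemma posdef_trace {R : realType} {d : nat} (g T : 'M[R]_d) : posdef g ->
  let t := \tr (invmx g *m T *m invmx g *m T^T) in 0 <= t /\ (t = 0 -> T = 0).
Proof.
move=> /posdef_factor[C uC ->] /=.
have uCT : C^T \in unitmx by rewrite unitmx_tr.
pose X := invmx C *m T *m (invmx C)^T.
have -> : invmx (C *m C^T) = (invmx C)^T *m invmx C.
  rewrite -[LHS]mulmx1 -(mulmxV uC) -[X in _ *m (X *m _)]mulmx1.
  rewrite -[1%:M in X in _ *m X](mulmxV uCT) !mulmxA -[_ *m C *m C^T]mulmxA.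
  rewrite mulVmx ?mul1mx ?trmx_inv// unitmx_mul uC; exact: uCT.
have -> : \tr ((invmx C)^T *m invmx C *m T *m ((invmx C)^T *m invmx C) *m T^T)
        = \tr (X *m X^T).
  rewrite -!mulmxA mxtrace_mulC !trmx_mul trmxK !mulmxA.
  by rewrite -!mulmxA.
rewrite mxtrace_mul_tr; split.
  by apply: sumr_ge0 => i _; apply: sumr_ge0 => j _; exact: sqr_ge0.
move=> /eqP; rewrite psumr_eq0; last first.
  by move=> i _; apply: sumr_ge0 => j _; exact: sqr_ge0.
move=> /allP X0; suff X00 : X = 0.
  have: C *m X *m C^T = 0 by rewrite X00 mulmx0 mul0mx.
  by rewrite /X !mulmxA mulmxV// mul1mx trmx_inv -mulmxA mulVmx// mulmx1.
apply/matrixP => i j; have := X0 i; rewrite mem_index_enum => /(_ isT).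
rewrite /= psumr_eq0; last by move=> k _; exact: sqr_ge0.
move=> /allP/(_ j); rewrite mem_index_enum => /(_ isT).
by rewrite /= sqrf_eq0 => /eqP ->; rewrite mxE.
Qed.

(** * Functions stable under field operations *)

(** Continuity at a point and continuous differentiability on an open set are
    both stable under the field operations.  Determinants, inverses and traces of
    matrices of functions only use these operations, so their regularity is
    established once, for an abstract P.  The set D is where a function matters: P
    does not see values outside D, and an inverse needs a nonzero denominator only
    on D. *)
Record fun_field {R : realType} {T : Type} (D : set T) (P : (T -> R) -> Prop) :
    Prop := FunField {
  ff_ext : forall f g, (forall t, D t -> f t = g t) -> P f -> P g ;
  ff_cst : forall c, P (fun=> c) ;
  ff_add : forall f g, P f -> P g -> P (fun t => f t + g t) ;
  ff_mul : forall f g, P f -> P g -> P (fun t => f t * g t) ;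
  ff_inv : forall f, (forall t, D t -> f t != 0) -> P f -> P (fun t => (f t)^-1) }.

Section FunField.
Context {R : realType} {T : Type} {D : set T} {P : (T -> R) -> Prop}.
Hypothesis FP : fun_field D P.

Lemma ff_opp f : P f -> P (fun t => - f t).
Proof.
move=> Pf; apply: (ff_ext _ _ FP (fun t => -1 * f t)).
  by move=> t _; rewrite mulN1r.
exact: (ff_mul _ _ FP _ _ (ff_cst _ _ FP _)).
Qed.

Lemma ff_sub f g : P f -> P g -> P (fun t => f t - g t).
Proof. by move=> Pf Pg; apply: (ff_add _ _ FP) => //; exact: ff_opp. Qed.

Lemma ff_sum (I : Type) (s : seq I) (F : I -> T -> R) :
  (forall i, P (F i)) -> P (fun t => \sum_(i <- s) F i t).
Proof.
move=> PF; elim: s => [|i s IH].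
  by apply: (ff_ext _ _ FP (fun=> 0)) (ff_cst _ _ FP _) => t _; rewrite big_nil.
apply: (ff_ext _ _ FP (fun t => F i t + \sum_(i <- s) F i t)).
  by move=> t _; rewrite big_cons.
exact: (ff_add _ _ FP).
Qed.

Lemma ff_prod (I : Type) (s : seq I) (F : I -> T -> R) :
  (forall i, P (F i)) -> P (fun t => \prod_(i <- s) F i t).
Proof.
move=> PF; elim: s => [|i s IH].
  by apply: (ff_ext _ _ FP (fun=> 1)) (ff_cst _ _ FP _) => t _; rewrite big_nil.
apply: (ff_ext _ _ FP (fun t => F i t * \prod_(i <- s) F i t)).
  by move=> t _; rewrite big_cons.
exact: (ff_mul _ _ FP).
Qed.

Lemma ff_det k (A : T -> 'M[R]_k) :
  (forall i j, P (fun t => A t i j)) -> P (fun t => \det (A t)).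
Proof.
move=> PA; apply: ff_sum => s; apply: (ff_mul _ _ FP); first exact: (ff_cst _ _ FP).
by apply: ff_prod => i; exact: PA.
Qed.

Lemma ff_mulmx k l m (A : T -> 'M[R]_(k, l)) (B : T -> 'M[R]_(l, m)) :
  (forall i j, P (fun t => A t i j)) -> (forall i j, P (fun t => B t i j)) ->
  forall i j, P (fun t => (A t *m B t) i j).
Proof.
move=> PA PB i j; apply: (ff_ext _ _ FP (fun t => \sum_k A t i k * B t k j)).
  by move=> t _; rewrite mxE.
by apply: ff_sum => x; exact: (ff_mul _ _ FP).
Qed.

Lemma ff_mxtrace k (A : T -> 'M[R]_k) :
  (forall i j, P (fun t => A t i j)) -> P (fun t => \tr (A t)).
Proof. by move=> PA; apply: ff_sum => i; exact: PA. Qed.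

(** Cramer's rule: the entries of the inverse are cofactors divided by the
    determinant. *)
Lemma ff_invmx k (A : T -> 'M[R]_k) :
  (forall t, D t -> A t \in unitmx) -> (forall i j, P (fun t => A t i j)) ->
  forall i j, P (fun t => invmx (A t) i j).
Proof.
move=> uA PA i j.
apply: (ff_ext _ _ FP (fun t => (\det (A t))^-1 *
   ((-1) ^+ (j + i) * \det (row' j (col' i (A t)))))).
  by move=> t /uA Dt; rewrite /invmx Dt !mxE.
apply: (ff_mul _ _ FP).
  apply: (ff_inv _ _ FP); last exact: ff_det.
  by move=> t /uA; rewrite unitmxE unitfE.
apply: (ff_mul _ _ FP); first exact: (ff_cst _ _ FP).
apply: ff_det => k' l.
by apply: (ff_ext _ _ FP _ _ _ (PA (lift j k') (lift i l))) => t _; rewrite !mxE.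
Qed.

End FunField.

(** A named predicate, so that unification recovers the function from an
    instance of the closure properties. *)
Definition cont_at {R : realType} {T : topologicalType} (p : T) (f : T -> R) : Prop :=
  {for p, continuous f}.

Lemma fun_field_continuous_at {R : realType} {T : topologicalType} (D : set T)
    (p : T) : nbhs p D ->
  fun_field D (@cont_at R T p).
Proof.
move=> nD; split.
- move=> f g fg cf; have Dp := nbhs_singleton nD.
  change (g @ p --> g p); rewrite -(fg p Dp).
  apply: cvg_trans cf; apply: near_eq_cvg.
  by apply: filterS nD => t /fg ->.
- by move=> c; exact: cvg_cst.
- by move=> f g; exact: continuousD.
- by move=> f g; exact: continuousM.
- move=> f f0 cf; apply: continuousV => //; apply: f0.
  exact: nbhs_singleton.
Qed.

Definition C1_on {R : realType} (D : set R) (f : R -> R) :=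
  forall r, D r -> derivable f r 1 /\ cont_at r (derive1 f).

Lemma C1_on_continuous {R : realType} (D : set R) f r :
  C1_on D f -> D r -> cont_at r f.
Proof.
by move=> Df /Df[df _]; apply: differentiable_continuous; exact/derivable1_diffP.
Qed.

Lemma fun_field_C1 {R : realType} (D : set R) : open D -> fun_field D (C1_on D).
Proof.
move=> oD.
have nD r : D r -> nbhs r D by move=> Dr; apply: open_nbhs_nbhs; split.
have ext (f g : R -> R) r : D r -> (forall t, D t -> f t = g t) ->
    cont_at r f -> cont_at r g.
  move=> Dr fg; exact: (ff_ext _ _ (@fun_field_continuous_at R _ _ _ (nD _ Dr)) _ _ fg).
split.
- move=> f g fg Pf.
  have near_fg r : D r -> \near r, f r = g r.
    by move=> Dr; apply: filterS (nD _ Dr) => t /fg.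
  move=> r Dr; have [df cf] := Pf r Dr; split.
    exact: near_eq_derivable (near_fg _ Dr) df.
  apply: (ext _ _ _ Dr _ cf) => t Dt.
  by rewrite !derive1E; exact: near_eq_derive (near_fg _ Dt).
- move=> c r Dr; split; first exact: derivable_cst.
  have -> : derive1 (fun=> c : R) = cst 0 by apply: funext => t; exact: derive1_cst.
  exact: cvg_cst.
- move=> f g Pf Pg r Dr; split; first exact: derivableD (Pf r Dr).1 (Pg r Dr).1.
  apply: (ext (fun t => derive1 f t + derive1 g t)) => //.
    move=> t Dt; have [[df _] [dg _]] := (Pf t Dt, Pg t Dt).
    by rewrite !derive1E; exact: esym (deriveD df dg).
  have [[_ cf] [_ cg]] := (Pf r Dr, Pg r Dr).
  exact: continuousD cf cg.
- move=> f g Pf Pg r Dr; split; first exact: derivableM (Pf r Dr).1 (Pg r Dr).1.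
  apply: (ext (fun t => f t * derive1 g t + g t * derive1 f t)) => //.
    move=> t Dt; have [[df _] [dg _]] := (Pf t Dt, Pg t Dt).
    by rewrite !derive1E; exact: esym (deriveM df dg).
  have [[_ cf] [_ cg]] := (Pf r Dr, Pg r Dr).
  have [cf0 cg0] := (C1_on_continuous _ _ _ Pf Dr, C1_on_continuous _ _ _ Pg Dr).
  exact: continuousD (continuousM cf0 cg) (continuousM cg0 cf).
- move=> f f0 Pf r Dr; have [df cf] := Pf r Dr; split.
    exact: derivableV (f0 _ Dr) df.
  apply: (ext (fun t => - ((f t)^-1 * (f t)^-1) * derive1 f t)) => //.
    move=> t Dt; have [df' _] := Pf t Dt.
    by rewrite !derive1E (deriveV (f0 _ Dt) df') /GRing.scale/= expr2 invfM.
  have cV := continuousV (f0 _ Dr) (C1_on_continuous _ _ _ Pf Dr).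
  exact: continuousM (continuousN (continuousM cV cV)) cf.
Qed.

(** * The Riccati identity for a curve of metrics *)

Definition mxderive {R : realType} {d : nat} (A : R -> 'M[R]_d) (r : R) : 'M[R]_d :=
  \matrix_(i, j) derive1 (fun s => A s i j) r.

(** The Weingarten map of the slices, for the curve A of metrics at one point. *)
Definition weinmx {R : realType} {d : nat} (A : R -> 'M[R]_d) (r : R) : 'M[R]_d :=
  2^-1 *: (invmx (A r) *m mxderive A r).

(** The density of the relative radial mass: sin^2 r times the difference
    d cot r - H, expanded so that nothing is divided by sin r. *)
Definition radial_flux {R : realType} {d : nat} (A : R -> 'M[R]_d) (r : R) : R :=
  d%:R * (sin r * cos r) - sin r ^+ 2 * \tr (weinmx A r).

(** How far W is from cot r, the Weingarten map of every metric warped by sin: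
    the trace of (W - cot r)^2, multiplied by sin^2 r to avoid divisions. *)
Definition excess {R : realType} {d : nat} (A : R -> 'M[R]_d) (r : R) : R :=
  \tr ((sin r *: weinmx A r - (cos r)%:M) *m (sin r *: weinmx A r - (cos r)%:M)).

(** The expression - H' - tr W^2, which is the radial Ricci curvature. *)
Definition riccati {R : realType} {d : nat} (A : R -> 'M[R]_d) (r : R) : R :=
  - derive1 (fun s => \tr (weinmx A s)) r - \tr (weinmx A r *m weinmx A r).

Lemma excessE {R : realType} {d : nat} (A : R -> 'M[R]_d) (r : R) :
  excess A r = sin r ^+ 2 * \tr (weinmx A r *m weinmx A r)
    - 2 * (sin r * cos r) * \tr (weinmx A r) + d%:R * cos r ^+ 2.
Proof.
rewrite /excess; move: (weinmx A r) => W.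
rewrite mulmxBl !mulmxBr -!scalemxAl -!scalemxAr -scalar_mxM.
rewrite mul_scalar_mx mul_mx_scalar.
have trB X Y : \tr (X - Y : 'M[R]_d) = \tr X - \tr Y by exact: raddfB.
rewrite !trB !mxtraceZ mxtrace_scalar -mulr_natl.
ring.
Qed.

Section RadialMatrix.
Context {R : realType} {d : nat} {D : set R} (A : R -> 'M[R]_d).
Hypothesis oD : open D.
Hypothesis pA : forall r, D r -> posdef (A r).

Let nD r : D r -> nbhs r D.
Proof. by move=> Dr; apply: open_nbhs_nbhs; split. Qed.

Lemma mxderive_sym r : D r -> (mxderive A r)^T = mxderive A r.
Proof.
move=> Dr; apply/matrixP => i j; rewrite !mxE !derive1E.
apply: near_eq_derive; apply: filterS (nD _ Dr) => s /pA[sA _].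
by rewrite -[in LHS]sA mxE.
Qed.

Let T r := (sin r / 2) *: mxderive A r - cos r *: A r.

Let excess_trace r : D r ->
  excess A r = \tr (invmx (A r) *m T r *m invmx (A r) *m (T r)^T).
Proof.
move=> Dr; have sT : (T r)^T = T r.
  by rewrite /T linearB/= !linearZ/= mxderive_sym// (pA _ Dr).1.
have -> : \tr (invmx (A r) *m T r *m invmx (A r) *m (T r)^T) =
    \tr ((invmx (A r) *m T r) *m (invmx (A r) *m T r)) by rewrite sT !mulmxA.
have -> : invmx (A r) *m T r = sin r *: weinmx A r - (cos r)%:M.
  rewrite /T mulmxBr -!scalemxAr mulVmx ?scalemx1; last exact/posdef_unit/pA.
  by rewrite /weinmx scalerA.
by [].
Qed.

Lemma excess_ge0 r : D r -> 0 <= excess A r.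
Proof. by move=> Dr; rewrite excess_trace//; exact: (posdef_trace _ _ (pA _ Dr)).1. Qed.

(** The vanishing tensor is T = (sin r / 2) A' - cos r A: the operator
    sin r W - cos r equals A^-1 T, and T is symmetric, so posdef_trace applies. *)
Lemma excess_eq0 r : D r -> excess A r = 0 ->
  sin r *: mxderive A r = (2 * cos r) *: A r.
Proof.
move=> Dr; rewrite excess_trace// => /(posdef_trace _ _ (pA _ Dr)).2.
move=> /eqP; rewrite subr_eq0 => /eqP h.
have -> : sin r = 2 * (sin r / 2) by field.
by rewrite -scalerA h scalerA.
Qed.

Hypothesis A1 : forall i j, C1_on D (fun s => A s i j).
Hypothesis A2 : forall i j, C1_on D (derive1 (fun s => A s i j)).

Lemma weinmx_C1 i j : C1_on D (fun s => weinmx A s i j).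
Proof.
have FP := fun_field_C1 D oD.
have uA r : D r -> A r \in unitmx by move=> /pA/posdef_unit.
apply: (ff_ext _ _ FP (fun s => 2^-1 * (invmx (A s) *m mxderive A s) i j)).
  by move=> s _; rewrite /weinmx [RHS]mxE.
apply: (ff_mul _ _ FP); first exact: (ff_cst _ _ FP).
apply: (ff_mulmx FP); first exact: ff_invmx FP _ _ uA A1.
move=> k l; apply: (ff_ext _ _ FP (derive1 (fun s => A s k l))) => [t _|]; last exact: A2.
by rewrite mxE.
Qed.

Lemma mxtrace_weinmx_C1 : C1_on D (fun s => \tr (weinmx A s)).
Proof. exact: (ff_mxtrace (fun_field_C1 D oD)) weinmx_C1. Qed.

Lemma excess_continuous r : D r -> cont_at r (excess A).
Proof.
move=> Dr; have FP := @fun_field_continuous_at R _ D r (nD _ Dr).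
have cs k l : cont_at r (fun s => weinmx A s k l).
  exact: C1_on_continuous (weinmx_C1 k l) Dr.
rewrite (_ : excess A = fun s => sin s ^+ 2 * \tr (weinmx A s *m weinmx A s)
    - 2 * (sin s * cos s) * \tr (weinmx A s) + d%:R * cos s ^+ 2); last first.
  by apply: funext => s; exact: excessE.
apply: (ff_add _ _ FP); first apply: (ff_sub FP).
- apply: (ff_mul _ _ FP); first by apply: (ff_mul _ _ FP); exact: continuous_sin.
  by apply: (ff_mxtrace FP); exact: (ff_mulmx FP).
- apply: (ff_mul _ _ FP); last exact: (ff_mxtrace FP).
  apply: (ff_mul _ _ FP); first exact: (ff_cst _ _ FP).
  by apply: (ff_mul _ _ FP); [exact: continuous_sin|exact: continuous_cos].
- apply: (ff_mul _ _ FP); first exact: (ff_cst _ _ FP).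
  by apply: (ff_mul _ _ FP); exact: continuous_cos.
Qed.

Lemma riccati_continuous r : D r -> cont_at r (riccati A).
Proof.
move=> Dr; have FP := @fun_field_continuous_at R _ D r (nD _ Dr).
have cs k l : cont_at r (fun s => weinmx A s k l).
  exact: C1_on_continuous (weinmx_C1 k l) Dr.
apply: (ff_sub FP); first by apply: (ff_opp FP); case: (mxtrace_weinmx_C1 r Dr).
by apply: (ff_mxtrace FP); exact: (ff_mulmx FP).
Qed.

(** The Riccati identity: the terms in tr W^2 cancel, and the remaining
    terms in H and in d complete the square. *)
Lemma radial_flux_derive r : D r ->
  is_derive r 1 (radial_flux A) ((riccati A r - d%:R) * sin r ^+ 2 + excess A r).
Proof.
move=> Dr; have [dH _] := mxtrace_weinmx_C1 r Dr.
have idH : is_derive r 1 (fun s => \tr (weinmx A s))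
    (derive1 (fun s => \tr (weinmx A s)) r) by rewrite derive1E; exact/derivableP.
have ds := is_derive_sin r; have dc := is_derive_cos r.
have df := is_deriveB (is_deriveM (is_derive_cst (d%:R : R) (r : R) 1) (is_deriveM ds dc))
  (is_deriveM (is_deriveM ds ds) idH).
have -> : radial_flux A = (cst d%:R * (sin * cos) -
    (sin * sin) * (fun s => \tr (weinmx A s))) :> (R -> R).
  by apply: funext => s; rewrite /radial_flux expr2.
apply: (is_derive_eq df).
rewrite excessE /riccati /GRing.scale/=.
rewrite -[(sin * cos) r]/(sin r * cos r) -[(sin * sin) r]/(sin r * sin r).
move: (derive1 _ r) (\tr (weinmx A r *m _)) (\tr _) => x y z.
ring.
Qed.

End RadialMatrix.

(** * Warped curves of metrics *)

Section Warping.
Context {R : realType} {d : nat} (A : R -> 'M[R]_d).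
Let D : set R := `]0, pi[.
Hypothesis pA : forall r, D r -> posdef (A r).

Let oD : open D. Proof. exact: itv_open. Qed.

Let sin_neq0 r : D r -> sin r != 0.
Proof. by rewrite /D/= in_itv/= => Dr; rewrite gt_eqF// sin_gt0_pi. Qed.

Lemma pi2_in : D (pi / 2).
Proof. by rewrite /D/= in_itv/=; have := @pi_gt0 R; lra. Qed.

(** For A = sin^2 S the constant factor S cancels: W = cot r is scalar. *)
Lemma weinmx_warped (S : 'M[R]_d) : (forall s, D s -> A s = sin s ^+ 2 *: S) ->
  forall r, D r -> sin r *: weinmx A r = (cos r)%:M.
Proof.
move=> AS r Dr; have s0 := sin_neq0 _ Dr.
have dA : mxderive A r = (2 * sin r * cos r) *: S.
  apply/matrixP => i j; rewrite !mxE derive1E.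
  rewrite (@near_eq_derive _ _ _ _ (fun s => sin s ^+ 2 * S i j)); last first.
    have : nbhs r D by apply: open_nbhs_nbhs; split.
    by apply: filterS => s /AS ->; rewrite mxE.
  have ds := is_derive_sin r.
  have df := is_deriveM (is_deriveM ds ds) (is_derive_cst (S i j : R) (r : R) 1).
  have -> : (fun s => sin s ^+ 2 * S i j) = (sin * sin) * cst (S i j) :> (R -> R).
    by apply: funext => s; rewrite expr2.
  rewrite (@derive_val _ _ _ _ _ _ _ df) /GRing.scale/=.
  ring.
rewrite /weinmx; have -> : mxderive A r = (2 * cos r / sin r) *: A r.
  by rewrite dA AS// scalerA; congr (_ *: _); field.
rewrite -scalemxAr mulVmx ; last exact/posdef_unit/pA.
by rewrite !scalerA scalemx1; congr (_%:M); field.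
Qed.

Lemma mxtrace_weinmx_warped S : (forall s, D s -> A s = sin s ^+ 2 *: S) ->
  forall r, D r -> sin r * \tr (weinmx A r) = d%:R * cos r.
Proof.
move=> AS r Dr.
by rewrite -mxtraceZ (weinmx_warped _ AS)// mxtrace_scalar mulr_natl.
Qed.

Lemma excess_warped S : (forall s, D s -> A s = sin s ^+ 2 *: S) ->
  forall r, D r -> excess A r = 0.
Proof.
by move=> AS r Dr; rewrite /excess (weinmx_warped _ AS)// subrr mul0mx mxtrace0.
Qed.

Hypothesis A1 : forall i j, C1_on D (fun s => A s i j).

(** Vanishing excess means sin r A' = 2 cos r A, so every entry of A / sin^2
    has zero derivative; the constant is its value at pi / 2, where sin is 1. *)
Lemma excess_eq0_warped : (forall r, D r -> excess A r = 0) ->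
  forall r, D r -> A r = sin r ^+ 2 *: A (pi / 2).
Proof.
move=> Q0.
suff H i j a b : D a -> D b -> a < b -> A a i j / sin a ^+ 2 = A b i j / sin b ^+ 2.
  have {}H r : D r -> forall i j, A r i j / sin r ^+ 2 = A (pi / 2) i j.
    move=> Dr i j; rewrite -[RHS]divr1 -[X in _ = _ / X](expr1n _ 2).
    rewrite -[X in _ / X ^+ 2]sin_pihalf.
    by have [/H->|/H->|->] := ltgtP r (pi / 2) => //; exact: pi2_in.
  move=> r Dr; apply/matrixP => i j; rewrite mxE -(H _ Dr) mulrC divfK//.
  by rewrite expf_neq0 ?sin_neq0.
move=> Da Db ab.
have abD r : r \in `[a, b] -> D r.
  by move: Da Db; rewrite /D/= !in_itv/=; lra.
have dq (r : R) : r \in `[a, b] -> is_derive r 1 (fun r => A r i j / sin r ^+ 2) 0.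
  move=> rab; have Dr := abD _ rab; have s0 := sin_neq0 _ Dr.
  have ds := is_derive_sin r.
  have dA : is_derive r 1 (fun s => A s i j) (mxderive A r i j).
    by rewrite mxE derive1E; apply/derivableP; case: (A1 i j r Dr).
  have ss0 : (sin * sin : R -> R) r != 0 by rewrite mulf_neq0.
  have df := is_deriveM dA (is_deriveV ss0 (is_deriveM ds ds)).
  have -> : (fun r => A r i j / sin r ^+ 2) =
      (fun s => A s i j) * (fun r => ((sin * sin : R -> R) r)^-1) :> (R -> R).
    by apply: funext => s; rewrite expr2.
  apply: (is_derive_eq df).
  have /matrixP/(_ i j) := excess_eq0 _ oD pA r Dr (Q0 _ Dr).
  rewrite mxE [RHS]mxE => h.
  rewrite -[(sin * sin) r]/(sin r * sin r) /GRing.scale/=.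
  have -> : mxderive A r i j = 2 * cos r * A r i j / sin r.
    by rewrite -h mulrC mulKf.
  by field.
have cf : {within `[a, b], continuous (fun r => A r i j / sin r ^+ 2)}.
  by apply: derivable_within_continuous => r rab; case: (dq _ rab).
have dq' x : x \in `]a, b[ -> is_derive x 1 (fun r => A r i j / sin r ^+ 2) 0.
  by move=> xab; apply: dq; exact: subset_itv_oo_cc xab.
have [c _ /eqP] := MVT_segment (ltW ab) dq' cf.
by rewrite mul0r subr_eq0 => /eqP.
Qed.

End Warping.

(** * Slices of a smooth function on a cylinder *)

Section Slices.
Context {R : realType} {d : nat}.

(** The point (s, x) of the cylinder; for fixed x this is the radial line. *)
Definition slice (x : 'rV[R]_d) (s : R) : 'rV[R]_(1 + d) :=
  row_mx (s%:M : 'M[R]_1) x.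

Lemma sliceD x s t : slice x (s + t) = slice x s + t *: evec (lshift d ord0).
Proof.
apply/rowP => j; rewrite !mxE; case: splitP => i ij; rewrite ?mxE /=.
  by rewrite ord1 (_ : j == _) ?mulr1//; apply/eqP/val_inj; rewrite /= ij ord1.
by rewrite (_ : j == _ = false) ?mulr0 ?addr0//; apply/eqP => /(congr1 val)/=; rewrite ij.
Qed.

Lemma continuous_slice2 {T : topologicalType} (p : T) (f : T -> R)
    (g : T -> 'rV[R]_d) :
  {for p, continuous f} -> {for p, continuous g} ->
  {for p, continuous (fun t => slice (g t) (f t))}.
Proof.
move=> cf cg; apply/cvg_ballP => e e0.
have nf : \forall t \near p, ball (f p) e (f t) by exact: cvg_ball cf _ e0.
have ng : \forall t \near p, ball (g p) e (g t) by exact: cvg_ball cg _ e0.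
near=> t; split => // i j; rewrite !mxE; case: splitP => k _.
  by rewrite !mxE !ord1 eqxx !mulr1n; near: t.
have [_] : ball (g p) e (g t) by near: t.
by rewrite ord1; exact.
Unshelve. all: by end_near. Qed.

Lemma slice_continuous x : continuous (slice x).
Proof.
by move=> s; apply: (continuous_slice2 s idfun (fun=> x)); [exact: cvg_id|exact: cvg_cst].
Qed.

Lemma slice_derivable (F : 'rV[R]_(1 + d) -> R) x s :
  derivable F (slice x s) (evec (lshift d ord0)) -> derivable (F \o slice x) s 1.
Proof.
rewrite /derivable; set u := (fun _ => _); set v := (fun _ => _).
suff -> : u = v by []; apply: funext => h; rewrite /u /v /=.
by rewrite [h *: 1]mulr1 (addrC h s) sliceD (addrC (slice x s)).
Qed.

Lemma slice_derive (F : 'rV[R]_(1 + d) -> R) x s :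
  derive1 (F \o slice x) s = 'D_(evec (lshift d ord0)) F (slice x s).
Proof.
rewrite derive1E /derive; set u := (fun _ => _); set v := (fun _ => _).
suff -> : u = v by []; apply: funext => h; rewrite /u /v /=.
by rewrite [h *: 1]mulr1 (addrC h s) sliceD (addrC (slice x s)).
Qed.

Lemma slice_C1 (V : set 'rV[R]_(1 + d)) F x : Cm_on 1 V F ->
  C1_on (slice x @^-1` V) (F \o slice x).
Proof.
move=> [_ /(_ (lshift d ord0))[dF [cF _]]] s Vs; split.
  exact/slice_derivable/dF.
have -> : derive1 (F \o slice x) = 'D_(evec (lshift d ord0)) F \o slice x.
  by apply: funext => t; exact: slice_derive.
by apply: continuous_comp; [exact: slice_continuous|exact: cF].
Qed.

End Slices.

Lemma C1_on_local {R : realType} (D : set R) (f : R -> R) :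
  (forall r, D r -> exists2 U, open U /\ U r & C1_on U f) -> C1_on D f.
Proof. by move=> H r /H[U [oU Ur]]; exact. Qed.

Lemma C1_on_ext {R : realType} (U : set R) (f g : R -> R) : open U ->
  (forall s, U s -> f s = g s) -> C1_on U f -> C1_on U g.
Proof. by move=> oU; exact: (ff_ext _ _ (fun_field_C1 _ oU)). Qed.

Lemma derive1_ext {R : realType} (U : set R) (f g : R -> R) : open U ->
  (forall s, U s -> f s = g s) -> forall s, U s -> derive1 f s = derive1 g s.
Proof.
move=> oU fg s Us; rewrite !derive1E; apply: near_eq_derive.
have : nbhs s U by apply: open_nbhs_nbhs; split.
by apply: filterS => t /fg.
Qed.

Section Cylinder.
Context {R : realType} {d : nat} (a b : R) (X : set 'rV[R]_d).
Variable f : 'rV[R]_(1 + d) -> R.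

Definition cylinder : set 'rV[R]_(1 + d) :=
  [set z | a < lsubmx z 0 0 < b /\ X (rsubmx z)].

Lemma cylinder_slice x s : cylinder (slice x s) <-> `]a, b[%classic s /\ X x.
Proof.
by rewrite /cylinder/= /slice row_mxKl row_mxKr in_itv/= mxE eqxx mulr1n.
Qed.

Hypothesis sf : smooth_on cylinder f.

(** A smooth function on the cylinder agrees near (r, x) with a function F
    that is smooth on a full neighbourhood.  Radial lines stay inside the cylinder,
    even over a boundary point of N, so the r-derivatives agree too. *)
Lemma smooth_cylinder r x : `]a, b[%classic r -> X x ->
  exists V F, [/\ open V, V (slice x r), forall m, Cm_on m V F,
   forall y s, V (slice y s) -> `]a, b[%classic s -> X y ->
     f (slice y s) = F (slice y s) &
   forall y s, V (slice y s) -> `]a, b[%classic s -> X y ->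
     derive1 (f \o slice y) s = 'D_(evec (lshift d ord0)) F (slice y s)].
Proof.
move=> rab Xx; have [|V [F [oV Vz mF fF]]] := sf (slice x r).
  exact/cylinder_slice.
exists V, F; split => //.
  by move=> y s Vys sab Xy; rewrite fF//; exact/cylinder_slice.
move=> y s Vys sab Xy; rewrite -slice_derive.
apply: (derive1_ext (slice y @^-1` V `&` `]a, b[)); last by split.
  apply: openI; last exact: itv_open.
  by apply: open_comp => // t _; exact: slice_continuous.
by move=> t [Vt tab] /=; rewrite fF//; exact/cylinder_slice.
Qed.

Lemma smooth_cylinder_C1 x : X x -> C1_on `]a, b[ (f \o slice x).
Proof.
move=> Xx; apply: C1_on_local => r rab.
have [V [F [oV Vr mF fF _]]] := smooth_cylinder r x rab Xx.
exists (slice x @^-1` V `&` `]a, b[).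
  split => //; apply: openI; last exact: itv_open.
  by apply: open_comp => // t _; exact: slice_continuous.
apply: (C1_on_ext _ (F \o slice x)).
- apply: openI; last exact: itv_open.
  by apply: open_comp => // t _; exact: slice_continuous.
- by move=> s [Vs sab]; rewrite /= fF.
- by move=> s [Vs _]; exact: slice_C1 (mF 1) s Vs.
Qed.

Lemma smooth_cylinder_C2 x : X x -> C1_on `]a, b[ (derive1 (f \o slice x)).
Proof.
move=> Xx; apply: C1_on_local => r rab.
have [V [F [oV Vr mF _ dfF]]] := smooth_cylinder r x rab Xx.
exists (slice x @^-1` V `&` `]a, b[).
  split => //; apply: openI; last exact: itv_open.
  by apply: open_comp => // t _; exact: slice_continuous.
apply: (C1_on_ext _ ('D_(evec (lshift d ord0)) F \o slice x)).
- apply: openI; last exact: itv_open.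
  by apply: open_comp => // t _; exact: slice_continuous.
- by move=> s [Vs sab]; rewrite dfF.
- have [_ /(_ (lshift d ord0))[_ mDF]] := mF 2.
  by move=> s [Vs _]; exact: slice_C1 mDF s Vs.
Qed.

(** A function and its r-derivative depend continuously on the point of N
    when r is fixed. *)
Lemma smooth_cylinder_cvg (T : topologicalType) (g : T -> 'rV[R]_d) (p : T) r :
  `]a, b[%classic r -> {for p, continuous g} -> (\forall q \near p, X (g q)) ->
  cont_at p (fun q => f (slice (g q) r)) /\
  cont_at p (fun q => derive1 (f \o slice (g q)) r).
Proof.
move=> rab cg nX; have Xp := nbhs_singleton nX.
have [V [F [oV Vr mF fF dfF]]] := smooth_cylinder r (g p) rab Xp.
have cs : {for p, continuous (fun q => slice (g q) r)}.
  by apply: (continuous_slice2 p (fun=> r)) => //; exact: cvg_cst.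
have nV : \forall q \near p, V (slice (g q) r) /\ X (g q).
  by apply: filterI => //; apply: cs; apply: open_nbhs_nbhs; split.
have ff := @fun_field_continuous_at R _ _ _ nV.
have [cF /(_ (lshift d ord0))[_ [cDF _]]] := mF 1; split.
- apply: (ff_ext _ _ ff (fun q => F (slice (g q) r))).
    by move=> q [Vq Xq]; rewrite fF.
  exact: (@continuous_comp _ _ _ (fun q => slice (g q) r) F p cs (cF _ Vr)).
- apply: (ff_ext _ _ ff (fun q => 'D_(evec (lshift d ord0)) F (slice (g q) r))).
    by move=> q [Vq Xq]; rewrite dfF.
  exact: (@continuous_comp _ _ _ (fun q => slice (g q) r) _ p cs (cDF _ Vr)).
Qed.

End Cylinder.

(** * Partial derivatives on a cylinder over a half-space chart *)

Lemma invmx_block_diag1 {R : realType} {d : nat} (S : 'M[R]_d) : S \in unitmx ->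
  invmx (block_mx (1%:M : 'M[R]_1) 0 0 S) = block_mx 1%:M 0 0 (invmx S).
Proof.
move=> uS.
have uB : block_mx (1%:M : 'M[R]_1) 0 0 S \in unitmx.
  by rewrite unitmxE det_lblock det1 mul1r -unitmxE.
have e : block_mx (1%:M : 'M[R]_1) 0 0 S *m block_mx 1%:M 0 0 (invmx S) = 1%:M.
  rewrite mulmx_block !mulmx0 !mul0mx mulmx1 mulmxV// !addr0 !add0r.
  by rewrite -scalar_mx_block.
by rewrite -[RHS](mulKmx uB) e mulmx1.
Qed.

Section RadialRicci.
Context {R : realType} {d : nat} {N : manifold R d}.
Variables (a b : R) (c : atlas N).
Let D := cyl_dom a b c.
Let X := cimg (chart c).
Let i0 : 'I_(1 + d) := lshift d ord0.

Let cyl_slice x s : D (slice x s) <-> `]a, b[%classic s /\ X x.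
Proof. exact: cylinder_slice. Qed.

Lemma cyl_dom_slice z : D z -> exists x s, [/\ z = slice x s, `]a, b[%classic s & X x].
Proof.
move=> [zab Xz]; exists (rsubmx z), (lsubmx z 0 0); split => //.
  by rewrite /slice -mx11_scalar hsubmxK.
Qed.

Lemma cyl_dom_radial x r : X x -> `]a, b[%classic r ->
  \forall t \near 0^', D (slice x r + t *: evec i0).
Proof.
move=> Xx rab; apply: nbhs_dnbhs.
have /nbhs_ballP[e e0 eD] : nbhs r `]a, b[%classic.
  by apply: open_nbhs_nbhs; split => //; exact: itv_open.
apply/nbhs_ballP; exists e => // t te; rewrite -sliceD; apply/cyl_slice.
split => //; apply: eD; move: te; rewrite /ball/= sub0r normrN => te.
by rewrite opprD addNKr normrN.
Qed.

Lemma near_right_dnbhs (P : set R) : (\forall t \near 0^', P t) ->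
  \forall t \near 0^'+, P t.
Proof.
rewrite /at_right /dnbhs !near_withinE; apply: filterS => t Pt t0.
by apply: Pt; rewrite gt_eqF.
Qed.

Lemma slice_shift x s (t : R) (k : 'I_d) :
  slice x s + t *: evec (rshift 1 k) = slice (x + t *: evec k) s.
Proof.
rewrite /slice; apply/rowP => j; rewrite !mxE; case: splitP => i ij; rewrite ?mxE /=.
  rewrite (_ : j == _ = false) ?mulr0 ?addr0//.
  by apply/eqP => /(congr1 val)/=; rewrite ij ord1.
congr (_ + _ * (nat_of_bool _)%:R); apply/eqP/eqP => [e|e].
  by apply/val_inj/(@addnI 1); rewrite -[LHS]ij e.
by apply/val_inj; rewrite /= ij e.
Qed.

(** The half-space only constrains a coordinate from below, so increasing any
    coordinate slightly does not leave the chart.  In particular the filters of the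
    one-sided partial derivatives are proper, and their limits are unique. *)
Lemma cyl_dom_shift j z : D z -> \forall t \near 0^'+, D (z + t *: evec j).
Proof.
move=> /cyl_dom_slice[x [s [-> sab Xx]]].
rewrite -(fintype.splitK j); case: (fintype.split j) => k /=.
  by rewrite ord1; apply: near_right_dnbhs; exact: cyl_dom_radial.
have [U oU XU] := cimg_open (chart c).
have hX y : X y <-> U y /\ halfspace R d y.
  by rewrite /X /cimg XU.
have [Ux hx] := (hX x).1 Xx.
have nU : \forall t \near (0 : R), U (x + t *: evec k).
  have ct : {for (0 : R), continuous (fun t : R => x + t *: evec k)}.
    apply: continuousD; first exact: cvg_cst.
    by apply: continuousZl; exact: cvg_id.
  apply: ct; apply: open_nbhs_nbhs; split => //.
  by rewrite scale0r addr0.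
rewrite /at_right near_withinE; apply: filterS nU => t Ut t0.
rewrite slice_shift; apply/cyl_slice; split => //; apply/hX; split => // i i0'.
by rewrite !mxE; apply: addr_ge0; [exact: hx|apply: mulr_ge0; [exact: ltW|exact: ler0n]].
Qed.

Lemma cyl_dom_proper j z : D z ->
  ProperFilter (within [set t | D (z + t *: evec j)] 0^').
Proof.
move=> Dz; apply: Build_ProperFilter => /=.
rewrite /within/= => /near_right_dnbhs h.
have := @filter_ex _ _ (at_right_proper_filter (0 : R)).
move=> /(_ _ (filterI h (cyl_dom_shift j z Dz)))[t [ht Dt]].
exact: ht.
Qed.

Lemma pderiv_cst j (f : 'rV[R]_(1 + d) -> R) k z : D z ->
  (forall y, D y -> f y = k) -> pderiv D j f z = 0.
Proof.
move=> Dz fk; have PF := cyl_dom_proper j z Dz.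
apply: cvg_lim => //; apply: cvg_near_cst.
rewrite near_withinE; apply: nearW => t Dt.
by rewrite !fk// subrr mulr0.
Qed.

(** The radial interval is open, so the restriction to the domain is
    invisible in the radial direction. *)
Lemma pderiv_radial f x r : `]a, b[%classic r -> X x ->
  pderiv D i0 f (slice x r) = derive1 (f \o slice x) r.
Proof.
move=> rab Xx; rewrite /pderiv /derive1.
have -> : within [set t | D (slice x r + t *: evec i0)] 0^' = 0^'.
  apply/seteqP; split => P.
    by move=> h; apply: filterS2 (cyl_dom_radial x r Xx rab) h => t Dt; exact.
  by apply: filterS => t Pt _.
set u := (fun _ => _); set v := (fun _ => _).
suff -> : u = v by []; apply: funext => h; rewrite /u /v /=.
by rewrite -sliceD (addrC r).
Qed.

End RadialRicci.

(** * The radial Ricci curvature *)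

Section RadialRicciCurvature.
Context {R : realType} {d : nat} {N : manifold R d}.
Variables (a b : R) (G : R -> tensor2 N) (c : atlas N).
Let D := cyl_dom a b c.
Let X := cimg (chart c).
Let i0 : 'I_(1 + d) := lshift d ord0.
Let g := cyl_metric G c.
Let A x s := G s c (cinv (chart c) x).

Lemma cyl_metric_slice x s : g (slice x s) = block_mx 1%:M 0 0 (A x s).
Proof. by rewrite /g /cyl_metric /slice row_mxKl row_mxKr mxE eqxx mulr1n. Qed.

Let g0 y m : g y i0 m = (m == i0)%:R.
Proof.
rewrite /g /cyl_metric; case: (fintype.split_ordP m) => k ->.
  by rewrite block_mxEul mxE !ord1 !eqxx.
by rewrite block_mxEur mxE; case: eqP => // /(congr1 val).
Qed.

Let g0' y m : g y m i0 = (m == i0)%:R.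
Proof.
rewrite /g /cyl_metric; case: (fintype.split_ordP m) => k ->.
  by rewrite block_mxEul mxE !ord1 !eqxx.
by rewrite block_mxEdl mxE; case: eqP => // /(congr1 val).
Qed.

Let dg0 z i m : D z -> pderiv D i (fun y => g y i0 m) z = 0.
Proof. by move=> Dz; apply: (pderiv_cst a b c i _ (m == i0)%:R z Dz) => y _; exact: g0. Qed.

Let dg0' z i m : D z -> pderiv D i (fun y => g y m i0) z = 0.
Proof. by move=> Dz; apply: (pderiv_cst a b c i _ (m == i0)%:R z Dz) => y _; exact: g0'. Qed.

(** The entries of the metric in the radial row and column are constant:
    radial lines are geodesics. *)
Lemma christoffel_radial_radial l z : D z -> christoffel D g l i0 i0 z = 0.
Proof.
move=> Dz; rewrite /christoffel big1 ?mulr0// => m _.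
by rewrite !dg0// addr0 subr0 mulr0.
Qed.

Hypothesis pA : forall x s, X x -> `]a, b[%classic s -> posdef (A x s).

Lemma christoffel_radial_upper j z : D z -> christoffel D g i0 i0 j z = 0.
Proof.
move=> Dz; have [x [s [zE sab Xx]]] := cyl_dom_slice a b c z Dz.
rewrite /christoffel big1 ?mulr0// => m _.
case: (fintype.split_ordP m) => k ->.
  by rewrite !ord1 -/i0 !dg0// dg0'// addr0 subr0 mulr0.
rewrite zE cyl_metric_slice invmx_block_diag1; last exact/posdef_unit/pA.
by rewrite block_mxEur mxE mul0r.
Qed.

(** Only the r-derivative of the metric on N survives among the three
    derivatives in the symbol. *)
Lemma christoffel_weinmx l j x s : X x -> `]a, b[%classic s ->
  christoffel D g (rshift 1 l) i0 (rshift 1 j) (slice x s) = weinmx (A x) s l j.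
Proof.
move=> Xx sab; have Dz : D (slice x s) by apply/cylinder_slice.
rewrite /christoffel big_split_ord/= big_ord1 -/i0.
rewrite dg0'// dg0// dg0// addr0 subr0 mulr0 add0r.
rewrite [RHS]mxE [in RHS]mxE; congr (_ * _); apply: eq_bigr => m _.
rewrite dg0// dg0// addr0 subr0 cyl_metric_slice invmx_block_diag1; last first.
  exact/posdef_unit/pA.
rewrite block_mxEdr; congr (_ * _).
rewrite (pderiv_radial a b c _ x s sab Xx).
have oab : open (`]a, b[%classic : set R) by exact: itv_open.
rewrite -(mxderive_sym (A x) oab (fun r => pA x r Xx) s sab) !mxE.
congr (derive1 _ s); apply: funext => t.
by rewrite /= cyl_metric_slice block_mxEdr.
Qed.

Hypothesis sG : forall i j, smooth_on D (fun z => g z i j).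

Lemma metric_slice_C1 x i j : X x -> C1_on `]a, b[ (fun s => A x s i j).
Proof.
move=> Xx; have := smooth_cylinder_C1 a b X _ (sG (rshift 1 i) (rshift 1 j)) x Xx.
congr C1_on; apply: funext => s /=.
by rewrite cyl_metric_slice block_mxEdr.
Qed.

Lemma metric_slice_C2 x i j : X x -> C1_on `]a, b[ (derive1 (fun s => A x s i j)).
Proof.
move=> Xx; have := smooth_cylinder_C2 a b X _ (sG (rshift 1 i) (rshift 1 j)) x Xx.
congr (C1_on _ (derive1 _)); apply: funext => s /=.
by rewrite cyl_metric_slice block_mxEdr.
Qed.

(** Of the terms of the Ricci tensor, those that contain a symbol with two
    radial indices vanish, and the others assemble into - H' - tr W^2. *)
Lemma ricci_rr x r : X x -> `]a, b[%classic r ->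
  ricci D g i0 i0 (slice x r) = riccati (A x) r.
Proof.
move=> Xx rab; have Dz : D (slice x r) by apply/cylinder_slice.
have oab : open (`]a, b[%classic : set R) by exact: itv_open.
have pz l : pderiv D l (christoffel D g l i0 i0) (slice x r) = 0.
  by apply: (pderiv_cst a b c l _ 0 _ Dz) => y Dy; exact: christoffel_radial_radial.
rewrite /ricci big_split_ord/= big_ord1 -/i0 pz.
rewrite subr0 add0r big1; last first.
  by move=> m _; rewrite !christoffel_radial_radial// !mulr0 subr0.
have dW i : derivable (fun s => weinmx (A x) s i i : R) r 1.
  exact: (weinmx_C1 (A x) oab (fun r => pA x r Xx) (fun i j => metric_slice_C1 x i j Xx)
    (fun i j => metric_slice_C2 x i j Xx) i i r rab).1.
rewrite add0r /riccati /mxtrace.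
have -> : derive1 (fun s => \sum_i weinmx (A x) s i i) r =
    \sum_i derive1 (fun s => weinmx (A x) s i i) r.
  have -> : (fun s => \sum_i weinmx (A x) s i i) =
      \sum_i (fun s => weinmx (A x) s i i).
    by apply: funext => s; rewrite fct_sumE.
  rewrite derive1E derive_sum; first by apply: eq_bigr => i _; rewrite derive1E.
  by move=> i; exact: dW.
rewrite -sumrN -sumrB; apply: eq_bigr => l _.
rewrite pz sub0r; congr (- _ + _).
  rewrite (pderiv_radial a b c _ x r rab Xx).
  apply: (derive1_ext _ _ _ oab _ _ rab) => s sab.
  by rewrite /= christoffel_weinmx.
rewrite big_split_ord/= big_ord1 -/i0 !christoffel_radial_radial// christoffel_radial_upper//.
rewrite mulr0 mul0r subr0 add0r [in RHS]mxE -sumrN; apply: eq_bigr => m _.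
by rewrite christoffel_radial_radial// mulr0 sub0r !christoffel_weinmx.
Qed.

End RadialRicciCurvature.

(** * Independence of the chart and continuity on N *)

Section ChangeOfFrame.
Context {R : realType} {d : nat} (D : set R) (A B : R -> 'M[R]_d) (J : 'M[R]_d).
Hypothesis oD : open D.
Hypothesis pA : forall s, D s -> posdef (A s).
Hypothesis B1 : forall i j, C1_on D (fun s => B s i j).
Hypothesis AB : forall s, D s -> A s = J *m B s *m J^T.

Let mxderive_mull (C : R -> 'M[R]_d) r : (forall i j, derivable (fun s => C s i j) r 1) ->
  mxderive (fun s => J *m C s) r = J *m mxderive C r.
Proof.
move=> dC; apply/matrixP => i j; rewrite !mxE derive1E.
have -> : (fun s => (J *m C s) i j) = \sum_k (J i k *: (fun s => C s k j)).
  by apply: funext => s; rewrite mxE fct_sumE.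
rewrite derive_sum; last by move=> k; exact: derivableZ.
by apply: eq_bigr => k _; rewrite deriveZ// mxE derive1E.
Qed.

Let mxderive_tr (C : R -> 'M[R]_d) r :
  mxderive (fun s => (C s)^T) r = (mxderive C r)^T.
Proof.
by apply/matrixP => i j; rewrite !mxE; congr derive1; apply: funext => s; rewrite mxE.
Qed.

Lemma mxderive_congr r : D r -> mxderive A r = J *m mxderive B r *m J^T.
Proof.
move=> Dr; have -> : mxderive A r = mxderive (fun s => J *m B s *m J^T) r.
  apply/matrixP => i j; rewrite !mxE.
  by apply: (derive1_ext D) => // s Ds; rewrite AB.
have dB i j : derivable (fun s => B s i j) r 1 by case: (B1 i j r Dr).
have -> : (fun s => J *m B s *m J^T) = (fun s => (J *m (J *m B s)^T)^T).
  by apply: funext => s; rewrite [RHS]trmx_mul trmxK.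
rewrite mxderive_tr mxderive_mull.
  by rewrite mxderive_tr mxderive_mull// trmx_mul trmxK.
move=> i j.
have -> : (fun s => (J *m B s)^T i j) = \sum_k (J j k *: (fun s => B s k i)).
  by apply: funext => s; rewrite !mxE fct_sumE.
by apply: derivable_sum => k; exact: derivableZ.
Qed.

(** The frame change J does not depend on r, so it factors out of both A and A';
    the Weingarten maps are conjugate by K = J^T.  That J is invertible follows
    from A being so. *)
Lemma weinmx_congr r : D r -> exists2 K, K \in unitmx &
  weinmx A r = invmx K *m weinmx B r *m K.
Proof.
move=> Dr; have uA := posdef_unit _ (pA r Dr).
have := uA; rewrite AB// !unitmx_mul => /andP[/andP[uJ uB] uJT].
exists J^T => //; rewrite /weinmx mxderive_congr// AB//.
rewrite -scalemxAr -scalemxAl; congr (_ *: _).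
suff -> : invmx (J *m B r *m J^T) = invmx J^T *m invmx (B r) *m invmx J.
  by rewrite !mulmxA mulmxKV.
have uJB : J *m B r *m J^T \in unitmx by rewrite -AB.
have e : J *m B r *m J^T *m (invmx J^T *m invmx (B r) *m invmx J) = 1%:M.
  by rewrite !mulmxA mulmxK// mulmxK// mulmxV.
by rewrite -[RHS](mulKmx uJB) e mulmx1.
Qed.

Lemma radial_flux_congr r : D r -> radial_flux A r = radial_flux B r.
Proof.
move=> Dr; have [K uK WE] := weinmx_congr r Dr; rewrite /radial_flux WE.
by rewrite mxtrace_mulC mulmxA mulmxV// mul1mx.
Qed.

Lemma excess_congr r : D r -> excess A r = excess B r.
Proof.
move=> Dr; have [K uK WE] := weinmx_congr r Dr; rewrite !excessE WE.
have -> : \tr (invmx K *m weinmx B r *m K *m (invmx K *m weinmx B r *m K)) =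
    \tr (weinmx B r *m weinmx B r).
  by rewrite !mulmxA mxtrace_mulC !mulmxA mulmxV// mul1mx mulmxK.
by rewrite [\tr (_ *m K)]mxtrace_mulC !mulmxA mulmxV// mul1mx.
Qed.

End ChangeOfFrame.

Lemma riemannian_posdef {R : realType} {d : nat} {N : manifold R d} (S : tensor2 N) c p :
  is_riemannian S -> cdom (chart c) p -> posdef (S c p).
Proof.
move=> [_ sS pS _] cp; split; first exact: sS.
by move=> v v0; exact: pS.
Qed.

Section CylinderMetric.
Context {R : realType} {d : nat} {N : manifold R d} (a b : R) (G : R -> tensor2 N).
Hypothesis hG : is_cyl_metric a b G.
Implicit Types (c : atlas N) (p : N).

(** The curve of metrics at p, read in the chart selected at p. *)
Definition radial p (s : R) : 'M[R]_d := G s (chart_at p) p.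

Lemma family_posdef c p s : cdom (chart c) p -> `]a, b[%classic s -> posdef (G s c p).
Proof.
rewrite /= in_itv/= => cp sab; apply: riemannian_posdef => //; exact: (hG.1 s sab).
Qed.

Let cinv_in c x : cimg (chart c) x -> cdom (chart c) (cinv (chart c) x).
Proof. by move=> [q cq <-]; rewrite cmapK. Qed.

Let in_cimg c p : cdom (chart c) p -> cimg (chart c) (cmap (chart c) p).
Proof. by move=> cp; exists p. Qed.

Lemma family_C1 c p i j : cdom (chart c) p -> C1_on `]a, b[ (fun s => G s c p i j).
Proof.
move=> cp; have := metric_slice_C1 a b G c (hG.2 c) _ i j (in_cimg c p cp).
by rewrite cmapK.
Qed.

Lemma family_C2 c p i j : cdom (chart c) p ->
  C1_on `]a, b[ (derive1 (fun s => G s c p i j)).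
Proof.
move=> cp; have := metric_slice_C2 a b G c (hG.2 c) _ i j (in_cimg c p cp).
by rewrite cmapK.
Qed.

Lemma radial_ricciE r p : `]a, b[%classic r ->
  radial_ricci a b G r p = riccati (radial p) r.
Proof.
move=> rab; rewrite /radial_ricci.
rewrite -[row_mx _ _]/(slice (cmap (chart (chart_at p)) p) r).
rewrite ricci_rr//.
- by rewrite cmapK//; exact: chart_atP.
- by move=> x s Xx sab; apply: family_posdef => //; exact: cinv_in.
- by move=> i j; exact: hG.2.
- by apply: in_cimg; exact: chart_atP.
Qed.

Let itvo : open (`]a, b[%classic : set R). Proof. exact: itv_open. Qed.

Let chart_change c c' p : cdom (chart c) p -> cdom (chart c') p ->
  exists J, forall s, `]a, b[%classic s -> G s c p = J *m G s c' p *m J^T.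
Proof.
move=> cp cp'; exists (transition_jacobian c c' p) => s; rewrite /= in_itv/= => sab.
by have [tG _ _ _] := hG.1 s sab; exact: tG.
Qed.

Lemma radial_flux_chart c p r : cdom (chart c) p -> `]a, b[%classic r ->
  radial_flux (radial p) r = radial_flux (fun s => G s c p) r.
Proof.
move=> cp rab; have [J JG] := chart_change _ _ _ (chart_atP p) cp.
apply: (radial_flux_congr _ _ _ J itvo) rab => //.
- by move=> s; apply: family_posdef; exact: chart_atP.
- by move=> i j; exact: family_C1.
Qed.

Lemma excess_chart c p r : cdom (chart c) p -> `]a, b[%classic r ->
  excess (radial p) r = excess (fun s => G s c p) r.
Proof.
move=> cp rab; have [J JG] := chart_change _ _ _ (chart_atP p) cp.
apply: (excess_congr _ _ _ J itvo) rab => //.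
- by move=> s; apply: family_posdef; exact: chart_atP.
- by move=> i j; exact: family_C1.
Qed.

Lemma nbhs_cdom c p : cdom (chart c) p -> nbhs p (cdom (chart c)).
Proof. by move=> cp; apply: open_nbhs_nbhs; split => //; exact: cdom_open. Qed.

Lemma cmap_continuous_at c p : cdom (chart c) p -> {for p, continuous (cmap (chart c))}.
Proof.
move=> cp; have := @cmap_continuous _ _ _ (chart c).
rewrite continuous_open_subspace; last exact: cdom_open.
by apply; rewrite inE.
Qed.

Lemma weinmx_continuous_at c p r i j : cdom (chart c) p -> `]a, b[%classic r ->
  cont_at p (fun q => weinmx (fun s => G s c q) r i j).
Proof.
move=> cp rab.
have FP := @fun_field_continuous_at R _ _ _ (nbhs_cdom c p cp).
have nX : \forall q \near p, cimg (chart c) (cmap (chart c) q).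
  exact: filterS (in_cimg c) (nbhs_cdom c p cp).
have cG k l := smooth_cylinder_cvg a b (cimg (chart c)) _
  (hG.2 c (rshift 1 k) (rshift 1 l)) _ _ p r rab (cmap_continuous_at c p cp)
  nX.
have GE q s k l : cdom (chart c) q ->
    cyl_metric G c (slice (cmap (chart c) q) s) (rshift 1 k) (rshift 1 l) = G s c q k l.
  by move=> cq; rewrite cyl_metric_slice block_mxEdr cmapK.
apply: (ff_ext _ _ FP (fun q => 2^-1 *
    (invmx (G r c q) *m mxderive (fun s => G s c q) r) i j)).
  by move=> q _; rewrite [RHS]mxE.
apply: (ff_mul _ _ FP); first exact: (ff_cst _ _ FP).
apply: (ff_mulmx FP) => [|k l].
  apply: (ff_invmx FP); first by move=> q cq; exact/posdef_unit/family_posdef.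
  move=> k l; apply: (ff_ext _ _ FP (fun q =>
    cyl_metric G c (slice (cmap (chart c) q) r) (rshift 1 k) (rshift 1 l))).
    by move=> q cq; exact: GE.
  exact: (cG k l).1.
apply: (ff_ext _ _ FP (fun q => derive1 ((fun z => cyl_metric G c z (rshift 1 k)
    (rshift 1 l)) \o slice (cmap (chart c) q)) r)); last exact: (cG k l).2.
by move=> q cq; rewrite mxE; congr derive1; apply: funext => s; exact: GE.
Qed.

Lemma radial_flux_continuous r : `]a, b[%classic r ->
  continuous (fun p : N => radial_flux (radial p) r : R).
Proof.
move=> rab p; set c := chart_at p; have cp : cdom (chart c) p := chart_atP p.
have FP := @fun_field_continuous_at R _ _ _ (nbhs_cdom c p cp).
apply: (ff_ext _ _ FP (fun q => radial_flux (fun s => G s c q) r)).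
  by move=> q cq; rewrite (radial_flux_chart c).
apply: (ff_sub FP); first exact: (ff_cst _ _ FP).
apply: (ff_mul _ _ FP); first exact: (ff_cst _ _ FP).
by apply: (ff_mxtrace FP) => i j; exact: weinmx_continuous_at.
Qed.

Lemma radial_excess_continuous r : `]a, b[%classic r ->
  continuous (fun p : N => excess (radial p) r : R).
Proof.
move=> rab p; set c := chart_at p; have cp : cdom (chart c) p := chart_atP p.
have FP := @fun_field_continuous_at R _ _ _ (nbhs_cdom c p cp).
apply: (ff_ext _ _ FP (fun q => sin r ^+ 2 *
  \tr (weinmx (fun s => G s c q) r *m weinmx (fun s => G s c q) r)
    - 2 * (sin r * cos r) * \tr (weinmx (fun s => G s c q) r) + d%:R * cos r ^+ 2)).
  by move=> q cq; rewrite (excess_chart c)// excessE.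
have cW i j := weinmx_continuous_at c p r i j cp rab.
apply: (ff_add _ _ FP); last exact: (ff_cst _ _ FP).
apply: (ff_sub FP).
  apply: (ff_mul _ _ FP); first exact: (ff_cst _ _ FP).
  by apply: (ff_mxtrace FP); exact: (ff_mulmx FP).
apply: (ff_mul _ _ FP); first exact: (ff_cst _ _ FP).
exact: (ff_mxtrace FP).
Qed.

End CylinderMetric.

(** * Riemannian measures *)

(** No measurability is assumed: the integral of a nonnegative function is a
    supremum over the simple functions below it.  This matters for iterated
    integrals, whose inner integrals need not be measurable functions. *)
Lemma ge0_integral_mono {d} {T : measurableType d} {R : realType}
    (mu : {measure set T -> \bar R}) (f g : T -> \bar R) :
  (forall x, 0 <= f x)%E -> (forall x, f x <= g x)%E ->
  (\int[mu]_(x in [set: T]) f x <= \int[mu]_(x in [set: T]) g x)%E.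
Proof.
move=> f0 fg; rewrite !ge0_integralTE//; last by move=> x; exact: le_trans (fg x).
apply: le_ereal_sup => _ [h hf <-]; exists h => // x.
exact: le_trans (hf x) (fg x).
Qed.

Lemma nbhs_open_sub {T : topologicalType} (p : T) (P : set T) : nbhs p P ->
  exists2 U : set T, open U /\ U p & U `<=` P.
Proof. by rewrite nbhsE => -[U [oU Up] UP]; exists U. Qed.

Section CubeIntegral.
Context {R : realType}.

Lemma lebesgue_iint_ge0 d (f : 'rV[R]_d -> \bar R) : (forall x, 0 <= f x)%E ->
  (0 <= lebesgue_iint f)%E.
Proof.
elim: d f => [|d IH] f f0 /=; first exact: f0.
by apply: integral_ge0 => t _; apply: IH => y; exact: f0.
Qed.

Lemma lebesgue_iint_mono d (f g : 'rV[R]_d -> \bar R) :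
  (forall x, 0 <= f x)%E -> (forall x, f x <= g x)%E ->
  (lebesgue_iint f <= lebesgue_iint g)%E.
Proof.
elim: d f g => [|d IH] f g f0 fg /=; first exact: fg.
apply: ge0_integral_mono => t; first by apply: lebesgue_iint_ge0 => y; exact: f0.
by apply: IH => y; [exact: f0|exact: fg].
Qed.

(** The point x is the lowest corner of the cube.  Hence a cube with its
    corner in a half-space lies in this half-space. *)
Definition cube d (x : 'rV[R]_d) (e : R) : set 'rV[R]_d :=
  [set y | forall i, x 0 i <= y 0 i <= x 0 i + e].

Lemma cube_row_mx d (x : 'rV[R]_(1 + d)) e t (y : 'rV[R]_d) :
  \1_(cube (1 + d) x e) (row_mx (t%:M : 'M[R]_1) y) =
  \1_`[x 0 (lshift d ord0), x 0 (lshift d ord0) + e] t *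
    \1_(cube d (rsubmx x) e) y :> R.
Proof.
rewrite !indicE -natrM mulnb; congr (nat_of_bool _)%:R.
apply/idP/andP; rewrite !inE /= in_itv/=.
  move=> h; split; first by have := h (lshift d ord0); rewrite row_mxEl mxE eqxx.
  by move=> i; have := h (rshift 1 i); rewrite row_mxEr mxE.
move=> [ht hy] i; case: (fintype.split_ordP i) => k ->.
  by rewrite row_mxEl ord1 mxE eqxx.
by have := hy k; rewrite row_mxEr mxE.
Qed.

Lemma lebesgue_iint_cube d (x : 'rV[R]_d) (K e : R) : 0 <= K -> 0 <= e ->
  lebesgue_iint (fun y => (K * \1_(cube d x e) y)%:E) = (K * e ^+ d)%:E.
Proof.
elim: d x K => [|d IH] x K K0 e0 /=.
  by rewrite indicE mem_set ?mulr1// => -[].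
pose a := x 0 (lshift d (ord0 : 'I_1)).
pose I := `[a, a + e]%classic : set R.
transitivity (\int[lebesgue_measure]_(t in [set: R]) ((K * e ^+ d) * \1_I t)%:E)%E.
  apply: eq_integral => t _.
  have := IH (rsubmx (x : 'rV[R]_(1 + d))) (K * \1_I t).
  rewrite mulrAC => <- //; last by rewrite mulr_ge0// indicE ler0n.
  by congr lebesgue_iint; apply: funext => y; rewrite cube_row_mx mulrA.
transitivity ((K * e ^+ d)%:E *
    \int[lebesgue_measure]_(t in [set: R]) (\1_I t)%:E)%E.
  have Ke0 : 0 <= K * e ^+ d by rewrite mulr_ge0// exprn_ge0.
  rewrite -ge0_integralZl_EFin//.
  by apply/measurable_EFinP; apply: measurable_indic; exact: measurable_itv.
have mI : measurable (I : set (measurableTypeR R)) by exact: measurable_itv.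
rewrite integral_indic; [|exact: measurableT|exact: mI].
rewrite setIT exprSr mulrA [in RHS]EFinM; congr (_ * _)%E.
have lI : lebesgue_measure (`[a, a + e]%classic : set R) = e%:E.
  rewrite lebesgue_measure_itv/= lte_fin.
  case: ltP => [_|]; first by rewrite -EFinD addrAC subrr add0r.
  by rewrite gerDl => e0'; congr EFin; apply/eqP; rewrite eq_le e0 e0'.
exact: lI.
Qed.

End CubeIntegral.

Section RiemannianMeasure.
Context {R : realType} {d : nat} {N : manifold R d} (S : tensor2 N).
Hypothesis hS : is_riemannian S.

Lemma riemannian_continuous_at c p i j : cdom (chart c) p ->
  cont_at p (fun q => S c q i j : R).
Proof.
move=> cp; have [_ _ _ sS] := hS.
have Xp : cimg (chart c) (cmap (chart c) p) by exists p.
have [V [F [oV Vp mF FS]]] := sS c i j _ Xp.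
have cc := cmap_continuous_at c p cp.
have nV : \forall q \near p, V (cmap (chart c) q) /\ cdom (chart c) q.
  apply: filterI; last exact: nbhs_cdom.
  by apply: cc; apply: open_nbhs_nbhs; split.
have FP := @fun_field_continuous_at R _ _ _ nV.
apply: (ff_ext _ _ FP (fun q => F (cmap (chart c) q))).
  by move=> q [Vq cq]; rewrite FS ?cmapK//; exists q.
exact: (@continuous_comp _ _ _ (cmap (chart c)) F p cc ((mF 0).1 _ Vp)).
Qed.

Definition density c (q : N) : R := Num.sqrt (\det (S c q)).

Lemma density_continuous_at c p : cdom (chart c) p -> cont_at p (density c).
Proof.
move=> cp; have FP := @fun_field_continuous_at R _ _ _ (nbhs_cdom c p cp).
have cd : cont_at p (fun q => \det (S c q)).
  by apply: (ff_det FP) => i j; exact: riemannian_continuous_at.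
exact: (@continuous_comp _ _ _ (fun q => \det (S c q)) Num.sqrt p cd (@sqrt_continuous R _)).
Qed.

Lemma density_gt0 c p : cdom (chart c) p -> 0 < density c p.
Proof.
move=> cp; have := riemannian_posdef _ c p hS cp.
move=> /posdef_factor[C uC SE]; rewrite /density SE sqrtr_gt0 det_mulmx det_tr -expr2.
by rewrite exprn_even_gt0//= -unitfE -unitmxE.
Qed.

Lemma borel_open (U : set (borel N)) : @open N U -> measurable U.
Proof. by move=> oU; exact: sub_gen_smallest. Qed.

Variable mu : {measure set (borel N) -> \bar R}.
Hypothesis hmu : is_riemannian_measure S mu.

(** Near p the density is at most its value at p plus one, and
    the chart maps a neighbourhood of p into a cube of side 2. *)
Lemma riemannian_measure_locally_finite (p : N) :
  exists2 U : set N, @open N U /\ U p & (mu U < +oo)%E.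
Proof.
set c := chart_at p; have cp : cdom (chart c) p := chart_atP p.
pose K := density c p + 1.
(* The cube of side 2 centred at the image of p has this lowest corner. *)
pose x : 'rV[R]_d := cmap (chart c) p - const_mx 1.
have nU : \forall q \near p, [/\ cdom (chart c) q, density c q < K &
    cube d x 2 (cmap (chart c) q)].
  have h1 := nbhs_cdom c p cp.
  have h2 : \forall q \near p, density c q < K.
    have cd : density c q @[q --> p] --> density c p by exact: density_continuous_at cp.
    by apply: (cvgr_lt _ cd); rewrite ltrDl.
  have h3 : \forall q \near p, ball (cmap (chart c) p) 1 (cmap (chart c) q).
    exact: cvg_ball (cmap_continuous_at c p cp) _ ltr01.
  near=> q; split; [by near: q|by near: q|].
  have [_ bq] : ball (cmap (chart c) p) 1 (cmap (chart c) q) by near: q.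
  move=> i; have := bq 0 i; rewrite /x !mxE /ball/= ltr_norml; lra.
have [U [oU Up] US] : exists2 U : set N, open U /\ U p & U `<=` [set q |
    [/\ cdom (chart c) q, density c q < K & cube d x 2 (cmap (chart c) q)]].
  exact: nbhs_open_sub nU.
exists U => //; rewrite (hmu c); first last.
- by move=> q /US[].
- exact: borel_open.
apply: (@le_lt_trans _ _ (lebesgue_iint (fun y => (K * \1_(cube d x 2) y)%:E))).
  apply: lebesgue_iint_mono => y; first by rewrite lee_fin mulr_ge0// indicE ler0n.
  rewrite lee_fin !indicE; case: (boolP (y \in _)) => [|_]; last first.
    by rewrite mul0r mulr_ge0// addr_ge0// ltW// density_gt0.
  rewrite inE => -[q Uq <-]; have [cq qK qC] := US q Uq.
  by rewrite mul1r cmapK// mem_set// mulr1 ltW.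
rewrite lebesgue_iint_cube ?ltry//.
by rewrite addr_ge0// ltW// density_gt0.
Unshelve. all: by end_near. Qed.

Lemma riemannian_measure_finite : compact [set: N] -> (mu [set: N] < +oo)%E.
Proof.
rewrite compact_cover => cN.
pose f p := projT1 (cid2 (riemannian_measure_locally_finite p)).
have fP p : (@open N (f p) /\ f p p) /\ (mu (f p) < +oo)%E.
  by rewrite /f; case: cid2.
have [||s _ sN] := cN N setT f.
- by move=> p _; exact: (fP p).1.1.
- by move=> p _; exists p => //; exact: (fP p).1.2.
suff [mA finA] : measurable (\bigcup_(i in [set` s]) f i : set (borel N)) /\
    (mu (\bigcup_(i in [set` s]) f i) < +oo)%E.
  by apply: le_lt_trans finA; apply: le_measure => //; rewrite inE//; exact: measurableT.
rewrite bigcup_fset; elim: (enum_fset s) => [|i r [mr finr]].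
  by rewrite big_nil measure0 ltry.
have mi : measurable (f i : set (borel N)) by exact: borel_open (fP i).1.1.
rewrite big_cons; split; first exact: measurableU.
apply: le_lt_trans (measureU2 _ mi mr) _.
by apply: lte_add_pinfty => //; exact: (fP i).2.
Qed.

(** In a chart at p the image of the open set contains a small cube with
    its corner at p, even if p lies on the boundary, and on that cube the density
    is bounded below by half its value at p. *)
Lemma riemannian_measure_open_gt0 (U : set N) : @open N U -> U !=set0 ->
  (0 < mu U)%E.
Proof.
move=> oU [p Up]; set c := chart_at p; have cp : cdom (chart c) p := chart_atP p.
pose k := density c p / 2.
have k0 : 0 < k by rewrite divr_gt0// density_gt0.
have nW : \forall q \near p, [/\ U q, cdom (chart c) q & k < density c q].
  have h0 : \forall q \near p, U q by apply: open_nbhs_nbhs; split.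
  have h1 := nbhs_cdom c p cp.
  have h2 : \forall q \near p, k < density c q.
    have cd : density c q @[q --> p] --> density c p by exact: density_continuous_at cp.
    apply: (cvgr_gt _ cd).
    by rewrite /k ltr_pdivrMr// ltr_pMr ?density_gt0// ltr1n.
  by near=> q; split; near: q.
have [W [oW Wp] WS] := nbhs_open_sub _ _ nW.
have mW : measurable (W : set (borel N)) by exact: borel_open.
have [Oc oO XO] := cimg_open (chart c).
set x := cmap (chart c) p; have Xx : cimg (chart c) x by exists p.
have Ux : Oc x by move: Xx; rewrite /cimg XO => -[].
have hx : halfspace R d x by move: Xx; rewrite /cimg XO => -[].
have nx : \forall y \near x, Oc y /\ (cimg (chart c) y -> W (cinv (chart c) y)).
  apply: filterI; first by apply: open_nbhs_nbhs; split.
  have := @cinv_continuous _ _ _ (chart c).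
  rewrite subspace_continuousP => /(_ x Xx).
  have nWx : nbhs (cinv (chart c) x) W.
    by rewrite /x cmapK//; apply: open_nbhs_nbhs; split.
  by move=> /(_ W nWx).
have [e e0 eS] := (nbhs_ballP _ _).1 nx.
pose e' := e / 2; have e'0 : 0 < e' by rewrite divr_gt0.
have cubeW y : cube d x e' y -> (cmap (chart c) @` W) y.
  move=> hy; have [Oy' yW] : Oc y /\ (cimg (chart c) y -> W (cinv (chart c) y)).
    apply: eS; split => // i j; rewrite ord1; have := hy j; rewrite /ball/= ltr_norml /e'.
    have ee : e = e / 2 + e / 2 by field.
    move: ee e'0; rewrite /e'; lra.
  have Xy : cimg (chart c) y.
    rewrite /cimg XO; split => // i i0; apply: le_trans (hx i i0) _.
    by case/andP: (hy i).
  exists (cinv (chart c) y); first exact: yW.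
  by case: Xy => q cq <-; rewrite cmapK.
apply: (@lt_le_trans _ _ (mu (W : set (borel N)))); last first.
  by apply: le_measure; rewrite ?inE => //; [exact: borel_open|move=> q /WS[]].
rewrite (hmu c)//; last by move=> q /WS[].
apply: (@lt_le_trans _ _ (lebesgue_iint (fun y => (k * \1_(cube d x e') y)%:E))).
  rewrite lebesgue_iint_cube ?ltW// lte_fin mulr_gt0//; exact: exprn_gt0.
apply: lebesgue_iint_mono => y.
  by rewrite lee_fin; apply: mulr_ge0; [exact: ltW|rewrite indicE ler0n].
rewrite lee_fin !indicE; case: (boolP (y \in cube d x e')) => [|_].
  rewrite inE => /cubeW[q Wq <-]; have [Uq cq kq] := WS q Wq.
  by rewrite mulr1 cmapK// mem_set ?mul1r ?ltW//; exists q.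
by rewrite mulr0 mulr_ge0// ler0n.
Unshelve. all: by end_near. Qed.

End RiemannianMeasure.

(** * Integration over a segment *)

Section Segment.
Context {R : realType}.
Notation leb := (@lebesgue_measure R).
Implicit Types (f u : R -> R) (s t : R).

Lemma segment_continuous f s t : (forall r, s <= r <= t -> cont_at r f) ->
  {within `[s, t], continuous f}.
Proof.
move=> cf; apply: continuous_in_subspaceT => r.
by rewrite inE/= in_itv/= => /cf.
Qed.

Lemma segment_integrable f s t : (forall r, s <= r <= t -> cont_at r f) ->
  leb.-integrable `[s, t] (EFin \o f).
Proof.
move=> cf; apply: continuous_compact_integrable; first exact: segment_compact.
exact: segment_continuous.
Qed.

Lemma segment_FTC u f s t : s < t -> (forall r, s <= r <= t -> cont_at r f) ->
  (forall r, s <= r <= t -> is_derive r 1 u (f r)) ->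
  \int[leb]_(r in `[s, t]) f r = u t - u s.
Proof.
move=> st cf du.
have cu r : s <= r <= t -> {for r, continuous u}.
  move=> /du[d1 _]; apply: differentiable_continuous; exact/derivable1_diffP.
rewrite /Rintegral (continuous_FTC2 st (segment_continuous _ _ _ cf) (F := u))//.
- split.
  + by move=> r; rewrite in_itv/= => /andP[sr rt]; have [] := du r _; rewrite ?ltW.
  + by apply: cvg_at_right_filter; apply: cu; rewrite lexx ltW.
  + by apply: cvg_at_left_filter; apply: cu; rewrite lexx ltW.
- move=> r; rewrite in_itv/= => /andP[sr rt]; rewrite derive1E.
  by have [] := du r _; rewrite ?ltW.
Qed.

(** If f(r) > 0 then f is at least f(r) / 2 on a segment around r, which
    contributes a positive amount to the integral. *)
Lemma segment_eq0 f s t : (forall r, s <= r <= t -> cont_at r f) ->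
  (forall r, s <= r <= t -> 0 <= f r) ->
  \int[leb]_(r in `[s, t]) f r = 0 -> forall r, s < r < t -> f r = 0.
Proof.
move=> cf f0 i0 r /andP[sr rt]; apply/eqP/contraT => fr.
have {fr}fr : 0 < f r by rewrite lt_def fr f0// !ltW.
have cr : f x @[x --> r] --> f r by apply: cf; rewrite !ltW.
have nr : \forall x \near r, f r / 2 < f x.
  by apply: (cvgr_gt _ cr); rewrite ltr_pdivrMr// ltr_pMr// ltr1n.
have nst : \forall x \near r, s <= x <= t.
  have : \forall x \near r, x \in `]s, t[.
    by apply: near_in_itvoo; rewrite in_itv/= sr.
  by apply: filterS => x; rewrite in_itv/= => /andP[sx xt]; rewrite !ltW.
have [e e0 He] := (nbhs_ballP _ _).1 (filterI nr nst).
have sub x : x \in `[r - e / 2, r + e / 2] -> f r / 2 < f x /\ s <= x <= t.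
  rewrite in_itv/= => xr; apply: He; rewrite /ball/= ltr_norml.
  by move: xr e0; rewrite /=; lra.
(* Half of the radius keeps the closed segment inside the open ball. *)
have e20 : r - e / 2 < r + e / 2 by move: e0; rewrite /=; lra.
have intf : leb.-integrable `[s, t] (EFin \o f) by exact: segment_integrable.
have ssub : `[r - e / 2, r + e / 2] `<=` `[s, t].
  by move=> x /sub[_]; rewrite /= in_itv.
have : \int[leb]_(x in `[r - e / 2, r + e / 2]) (f r / 2) <= \int[leb]_(x in `[s, t]) f x.
  apply: (@le_trans _ _ (\int[leb]_(x in `[r - e / 2, r + e / 2]) f x)).
    apply: le_Rintegral => //.
    - by apply: segment_integrable => x _; exact: cvg_cst.
    - exact: integrableS intf.
    - by move=> x xe; apply: ltW; case: (sub x xe).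
  rewrite fine_le//.
  - by apply: integrable_fin_num => //; exact: integrableS intf.
  - exact: integrable_fin_num.
  - apply: ge0_subset_integral => //; first exact: measurable_int intf.
rewrite i0 Rintegral_cst//= lebesgue_measure_itv/= lte_fin e20 -EFinD/=.
rewrite leNgt => /negP[]; apply: mulr_gt0; first by rewrite divr_gt0.
by rewrite subr_gt0.
Qed.

End Segment.

(** * Exhaustion of the cylinder by compact pieces *)

Section Exhaustion.
Context {R : realType} {dX : measure_display} {X : measurableType dX}.
Notation leb := (@lebesgue_measure R).
Variables (mu : {sigma_finite_measure set X -> \bar R}) (lo hi : R).
Variables (u Q : R -> X -> R) (F : R * X -> R).
Local Notation vol := (leb \x mu)%E.
Local Notation M := (`]lo, hi[ `*` [set: X]).
Local Notation mass r := (\int[mu]_(p in [set: X]) u r p).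

Hypothesis lohi : lo < hi.
Hypothesis mufin : (mu [set: X] < +oo)%E.
Hypothesis cF : forall p r, lo < r < hi -> cont_at r (fun s => F (s, p)).
Hypothesis cQ : forall p r, lo < r < hi -> cont_at r (fun s => Q s p).
Hypothesis Q_ge0 : forall p r, lo < r < hi -> 0 <= Q r p.
Hypothesis du : forall p r, lo < r < hi ->
  is_derive r 1 (fun s => u s p) (F (r, p) + Q r p).
Hypothesis mu_u : forall r, lo < r < hi -> measurable_fun [set: X] (u r).
Hypothesis bnd_u : forall r, lo < r < hi -> [bounded u r p | p in [set: X]].
Hypothesis intF : vol.-integrable M (EFin \o F).

Let E s t : set (R * X) := `[s, t] `*` [set: X].
Let q s t p := \int[leb]_(r in `[s, t]) Q r p.
Let g s t p := \int[leb]_(r in `[s, t]) F (r, p).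

Let mM : measurable (M : set (measurableTypeR R * X)).
Proof. by apply: measurableX => //; exact: measurable_itv. Qed.

Let mE s t : measurable (E s t : set (measurableTypeR R * X)).
Proof. by apply: measurableX => //; exact: measurable_itv. Qed.

Let u_integrable r : lo < r < hi -> mu.-integrable setT (EFin \o u r).
Proof.
move=> rI; apply: measurable_bounded_integrable => //; first exact: mu_u.
exact: bnd_u.
Qed.

Section OneSegment.
Variables (s t : R).
Hypotheses (los : lo < s) (st : s < t) (thi : t < hi).

Let inI r : s <= r <= t -> lo < r < hi.
Proof. by move=> /andP[sr rt]; rewrite (lt_le_trans los)//= (le_lt_trans rt). Qed.

Let gq p : g s t p + q s t p = u t p - u s p.
Proof.
rewrite -RintegralD//.
- apply: (@segment_FTC _ (u^~ p)) => // r /inI rI; last exact: du.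
  by apply: continuousD; [exact: cF|exact: cQ].
- by apply: segment_integrable => r /inI; exact: cF.
- by apply: segment_integrable => r /inI; exact: cQ.
Qed.

Let f := (EFin \o F) \_ (E s t).

Let f_integrable : vol.-integrable setT f.
Proof.
rewrite -(integrable_mkcond _ (mE s t)).
apply: (integrableS mM (mE s t) _ intF).
move=> [r p] [/= rI _]; split => //=; move: rI; rewrite !in_itv/=.
exact: inI.
Qed.

Let f_slice p : (fun r => f (r, p)) = (fun r => (F (r, p))%:E) \_ `[s, t].
Proof.
apply: funext => r; rewrite /f /patch /E.
case: ifPn => [|h]; first by rewrite inE => -[/= rI _]; rewrite mem_set.
by rewrite memNset// => rI; move: h; rewrite notin_setE; apply.
Qed.

Let gE p : (g s t p)%:E = fubini_G leb f p.
Proof.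
rewrite /fubini_G f_slice -integral_mkcond /g /Rintegral fineK//.
apply: integrable_fin_num => //.
by apply: (@segment_integrable _ (fun r => F (r, p))) => r /inI; exact: cF.
Qed.

Let mg : measurable_fun setT (g s t).
Proof.
apply/measurable_EFinP.
rewrite (_ : EFin \o g s t = fubini_G leb f); last exact/funext.
exact: (measurable_fubini_G f_integrable).
Qed.

Let g_integrable : mu.-integrable setT (EFin \o g s t).
Proof.
apply/integrableP; split; first exact/measurable_EFinP.
have mf := measurable_int _ f_integrable.
rewrite (le_lt_trans _ ((integrable21ltyP _ _ mf).1 f_integrable))//.
apply: ge0_le_integral => //.
- by apply: measurableT_comp => //; exact/measurable_EFinP.
- have mf' : measurable_fun setT (abse \o f) by exact: measurableT_comp.
  exact: (@measurable_fun_fubini_tonelli_G _ _ _ _ _ leb _ mf' (fun=> abse_ge0 _)).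
- move=> p _; change (`|(g s t p)%:E| <= \int[leb]_x `|f (x, p)|)%E.
  rewrite gE /fubini_G; apply: le_abse_integral => //.
  exact: (measurable_fun_pair1 p mf).
Qed.

Let gI : \int[mu]_(p in [set: X]) g s t p = \int[vol]_(z in E s t) F z.
Proof.
rewrite /Rintegral; congr fine; rewrite [RHS]integral_mkcond.
rewrite -(integral21_prod_meas1 f_integrable).
by apply: eq_integral => p _; rewrite -gE.
Qed.

(** The fundamental theorem of calculus on each radial segment, followed
    by Fubini's theorem for F.  Measurability of Q on the product is avoided:
    the integral q of Q along a segment is a difference of two measurable
    functions. *)
Lemma defect_segment :
  mu.-integrable setT (EFin \o q s t) /\
  mass t - mass s - \int[vol]_(z in E s t) F z = \int[mu]_(p in [set: X]) q s t p.
Proof.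
have iu r : s <= r <= t -> mu.-integrable setT (EFin \o u r).
  by move=> /inI; exact: u_integrable.
have it : mu.-integrable setT (EFin \o u t) by apply: iu; rewrite ltW/=.
have is' : mu.-integrable setT (EFin \o u s) by apply: iu; rewrite lexx ltW.
have qE : q s t = (fun p => (u t p - u s p) - g s t p).
  by apply: funext => p; rewrite -gq addrC addKr.
have ius : mu.-integrable setT (EFin \o (fun p => u t p - u s p)).
  exact: (integrableB measurableT it is').
rewrite qE; split; first exact: (integrableB measurableT ius g_integrable).
by rewrite RintegralB// RintegralB// gI.
Qed.

Lemma q_ge0 p : 0 <= q s t p.
Proof.
apply: Rintegral_ge0 => r; rewrite /= in_itv/= => /inI; exact: Q_ge0.
Qed.

End OneSegment.

Lemma q_mono s s' t' t p : lo < s -> s <= s' -> s' < t' -> t' <= t -> t < hi ->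
  q s' t' p <= q s t p.
Proof.
move=> los ss st tt thi.
have inI r : s <= r <= t -> lo < r < hi.
  by move=> /andP[sr rt]; rewrite (lt_le_trans los)//= (le_lt_trans rt).
have iQ : leb.-integrable `[s, t] (fun r => (Q r p)%:E).
  by apply: (@segment_integrable _ (Q^~ p)) => r /inI; exact: cQ.
have sub : `[s', t'] `<=` `[s, t].
  move=> r; rewrite /= !in_itv/= => /andP[h1 h2].
  by rewrite (le_trans ss)//= (le_trans h2).
rewrite /q /Rintegral fine_le//.
- by apply: integrable_fin_num => //; exact: integrableS iQ.
- exact: integrable_fin_num.
- apply: ge0_subset_integral => //; first exact: measurable_int iQ.
  by move=> r; rewrite /= in_itv/= lee_fin => /inI; exact: Q_ge0.
Qed.

(* The factor 1/3 makes the segment nonempty already for k = 0. *)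
Let c (k : nat) : R := (hi - lo) / 3 * k.+1%:R^-1.

Let c_bounds k : 0 < c k <= (hi - lo) / 3.
Proof.
have h3 : 0 < (hi - lo) / 3 by rewrite divr_gt0// subr_gt0.
by rewrite mulr_gt0//= ger_pMr// invf_le1// ler1n.
Qed.

Let cvg_c : c k @[k --> \oo] --> 0.
Proof.
have -> : c = (fun k => (hi - lo) / 3 * harmonic k) by [].
by rewrite -(mulr0 ((hi - lo) / 3)); apply: cvgMr; exact: cvg_harmonic.
Qed.

Let a k := lo + c k.
Let b k := hi - c k.

Let ab k : [/\ lo < a k, a k < b k & b k < hi].
Proof.
by have /andP[c0 c1] := c_bounds k; rewrite /a /b; split; move: c0 c1 lohi; lra.
Qed.

Let near_ab s t : lo < s -> t < hi -> \forall k \near \oo, a k <= s /\ t <= b k.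
Proof.
move=> los thi; have h1 : 0 < Num.min (s - lo) (hi - t).
  by rewrite lt_min !subr_gt0 los.
have : \forall k \near \oo, c k < Num.min (s - lo) (hi - t).
  exact: (cvgr_lt _ cvg_c).
apply: filterS => k; rewrite lt_min => /andP[]; rewrite /a /b; lra.
Qed.

Let intE_cvg :
  \int[vol]_(z in E (a k) (b k)) F z @[k --> \oo] --> \int[vol]_(z in M) F z.
Proof.
have EM k : E (a k) (b k) `<=` M.
  move=> [r p] [/= rI _]; split => //=; move: rI; rewrite !in_itv/= => /andP[ar rb].
  by have [la _ bh] := ab k; rewrite (lt_le_trans la)//= (le_lt_trans rb).
pose f k := (EFin \o F) \_ (E (a k) (b k)).
have intf k : (\int[vol]_(z in M) f k z = \int[vol]_(z in E (a k) (b k)) (F z)%:E)%E.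
  by rewrite /f -integral_mkcondr setIidr//; exact: EM.
have fin : (\int[vol]_(z in M) (F z)%:E)%E \is a fin_num by exact: integrable_fin_num.
apply: (@fine_cvg _ _ \oo _ (fun k => \int[vol]_(z in E (a k) (b k)) (F z)%:E)%E).
rewrite fineK//.
rewrite (_ : (fun k => _) = (fun k => \int[vol]_(z in M) f k z)%E); last first.
  by apply: funext => k; rewrite intf.
have mF := measurable_int _ intF.
(* The truncations of F are eventually constant at every point of the cylinder. *)
apply: (@dominated_cvg _ _ _ vol M mM f _ (fun z => `|F z|%:E)).
- move=> k; apply: (measurable_restrict _ (mE (a k) (b k)) mM).1.
  apply: (measurable_funS mM _ mF); exact: subIsetl.
- move=> [r p] [/=]; rewrite in_itv/= => /andP[lr rh] _.
  apply: cvg_near_cst; apply: filterS (near_ab r r lr rh) => k [ar rb].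
  by rewrite /f patchE mem_set//; split => //=; rewrite in_itv/= ar.
- by [].
- exact: integrable_abse intF.
- by move=> k z _; rewrite /f patchE; case: ifPn => // _; rewrite abse0 lee_fin.
Qed.

Variables (m0 m1 : R).
Hypothesis mass_lo : mass r @[r --> lo^'+] --> m0.
Hypothesis mass_hi : mass r @[r --> hi^'-] --> m1.

Let defect_cvg : \int[mu]_(p in [set: X]) q (a k) (b k) p @[k --> \oo] -->
  m1 - m0 - \int[vol]_(z in M) F z.
Proof.
have -> : (fun k => \int[mu]_(p in [set: X]) q (a k) (b k) p) =
    (fun k => mass (b k) - mass (a k) - \int[vol]_(z in E (a k) (b k)) F z).
  by apply: funext => k; have [la lab bh] := ab k; rewrite (defect_segment _ _ la lab bh).2.
have ca : a k @[k --> \oo] --> lo.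
  by rewrite -[X in _ --> X]addr0; apply: cvgD => //; exact: cvg_cst.
have cb : b k @[k --> \oo] --> hi.
  by rewrite -[X in _ --> X]subr0; apply: cvgB => //; exact: cvg_cst.
apply: cvgB => //; apply: cvgB.
- by have /cvg_at_leftP := mass_hi; apply; split => // k; case: (ab k).
- by have /cvg_at_rightP := mass_lo; apply; split => // k; case: (ab k).
Qed.

Lemma defect_ge0 : \int[vol]_(z in M) F z <= m1 - m0.
Proof.
rewrite -subr_ge0; apply: (ler_cvg_to (cvg_cst 0) defect_cvg).
apply: nearW => k; apply: Rintegral_ge0 => p _.
by have [la lab bh] := ab k; exact: q_ge0.
Qed.

Lemma defect_eq0 : (forall r p, lo < r < hi -> Q r p = 0) ->
  m1 - m0 = \int[vol]_(z in M) F z.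
Proof.
move=> Q0; apply/eqP; rewrite -subr_eq0; apply/eqP.
suff q0 : (fun k => \int[mu]_(p in [set: X]) q (a k) (b k) p) = cst 0.
  by have := defect_cvg; rewrite q0 => dc; exact: (cvg_unique _ dc (cvg_cst 0)).
apply: funext => k; have [la lab bh] := ab k.
rewrite (_ : q _ _ = cst 0); first by rewrite /Rintegral integral0.
apply: funext => p; rewrite /q /Rintegral integral0_eq// => r.
rewrite /= in_itv/= => /andP[ar rb]; rewrite Q0//.
by rewrite (lt_le_trans la)//= (le_lt_trans rb).
Qed.

(** The integral over a fixed segment [s, t] is dominated by the integrals
    over the exhausting segments, and these tend to zero. *)
Lemma defect_eq0_ae : m1 - m0 = \int[vol]_(z in M) F z ->
  forall s t, lo < s -> s < t -> t < hi ->
  {ae mu, forall p, forall r, s < r < t -> Q r p = 0}.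
Proof.
move=> eq_mass s t los st thi.
have [iq _] := defect_segment _ _ los st thi.
have q0 p := q_ge0 _ _ los thi p.
have le0 : \int[mu]_(p in [set: X]) q s t p <= 0.
  have := defect_cvg; rewrite eq_mass subrr => dc.
  apply: (ler_cvg_to (cvg_cst (\int[mu]_(p in [set: X]) q s t p)) dc).
  apply: filterS (near_ab s t los thi) => k [ak bk]; have [la lab bh] := ab k.
  apply: le_Rintegral => //; first exact: (defect_segment _ _ la lab bh).1.
  by move=> p _; exact: q_mono.
have : ae_eq mu setT (EFin \o q s t) (cst 0%E).
  apply/ae_eq_integral_abs => //; first exact: measurable_int iq.
  under eq_integral => p _ do rewrite /= ger0_norm//.
  apply: le_anti; rewrite integral_ge0 ?andbT; last by move=> p _; rewrite lee_fin.
  by rewrite -[leLHS]fineK ?lee_fin//; exact: integrable_fin_num.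
apply: filterS => p /(_ I) /= [qp].
apply: segment_eq0 qp => r /andP[sr rt].
  by apply: cQ; rewrite (lt_le_trans los)//= (le_lt_trans rt).
by apply: Q_ge0; rewrite (lt_le_trans los)//= (le_lt_trans rt).
Qed.

End Exhaustion.

(** * The mass inequality *)

Lemma posdefZ {R : realType} {d : nat} (k : R) (A : 'M[R]_d) :
  0 < k -> posdef A -> posdef (k *: A).
Proof.
move=> k0 [sA pA]; split; first by rewrite linearZ/= sA.
by move=> v v0; rewrite -scalemxAr -scalemxAl mxE mulr_gt0 ?pA.
Qed.

(** The norm contracts two inverse metrics with two copies of the tensor, so a
    common factor cancels. *)
Lemma tensor_norm_scale {R : realType} {d : nat} (k : R) (A T : 'M[R]_d) :
  0 < k -> posdef A -> tensor_norm (k *: A) (k *: T) = tensor_norm A T.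
Proof.
move=> k0 pA; rewrite /tensor_norm invmxZ; last exact/posdef_unit/posdefZ.
have -> : (k *: T)^T = k *: T^T by rewrite linearZ.
rewrite -!(scalemxAl, scalemxAr) !scalerA.
have -> : k^-1 * (k / k * k) = 1 by field; rewrite gt_eqF.
by rewrite scale1r.
Qed.

Lemma tensor_norm_eq0 {R : realType} {d : nat} (A T : 'M[R]_d) :
  posdef A -> (forall e, 0 < e -> tensor_norm A T < e) -> T = 0.
Proof.
move=> pA small; have [t0 tT] := posdef_trace A T pA; apply: tT.
apply/eqP/contraT => tN0; have tp : 0 < tensor_norm A T.
  by rewrite sqrtr_gt0 lt_def tN0.
by have := small _ tp; rewrite ltxx.
Qed.

(** Neighbourhoods of a point of the closed interval meet the open
    interval, including at the two end points. *)
Lemma within_itv_ex {R : realType} (lo hi r0 : R) (P : R -> Prop) :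
  lo < hi -> lo <= r0 <= hi -> (\forall r \near within `]lo, hi[ (nbhs r0), P r) ->
  exists2 r, lo < r < hi & P r.
Proof.
move=> lohi /andP[lor rhi]; rewrite near_withinE => /nbhs_ballP[e /= e0 eP].
pose m := Num.min e (hi - lo).
have m0 : 0 < m by rewrite lt_min e0 subr_gt0.
have [me mh] : m <= e /\ m <= hi - lo by rewrite /m !ge_min !lexx orbT.
have [r0l|r0h] := leP r0 ((lo + hi) / 2).
  exists (r0 + m / 4); first by apply/andP; split; lra.
  apply: eP; last by rewrite /= in_itv/=; apply/andP; split; lra.
  rewrite /ball/= ltr_norml; apply/andP; split; lra.
exists (r0 - m / 4); first by apply/andP; split; lra.
apply: eP; last by rewrite /= in_itv/=; apply/andP; split; lra.
rewrite /ball/= ltr_norml; apply/andP; split; lra.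
Qed.

Lemma between_halves {R : realFieldType} (r t : R) : 0 < r < t ->
  [/\ 0 < r / 2, r / 2 < (r + t) / 2, (r + t) / 2 < t & r / 2 < r < (r + t) / 2].
Proof. by move=> /andP[r0 rt]; split; [lra..|apply/andP; split; lra]. Qed.

Section BorelFunctions.
Context {R : realType} {d : nat} {N : manifold R d}.

Lemma borel_continuous_measurable (f : N -> R) : continuous f ->
  measurable_fun [set: borel N] (f : borel N -> R).
Proof.
move=> /continuousP cf; apply: (measurability _ (RGenOpens.measurableE R)) => //.
by move=> _ [_ [a [b ->] <-]]; rewrite setTI; apply: borel_open; apply: cf; exact: interval_open.
Qed.

Lemma compact_continuous_bounded (f : N -> R) : compact [set: N] -> continuous f ->
  [bounded f p | p in [set: N]].
Proof.
move=> cN cf; have cK := continuous_compact (continuous_subspaceT cf) cN.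
have [K [Kr KK]] := compact_bounded cK.
by exists K; split => // x Kx p _; apply: (KK x Kx); exists p.
Qed.

End BorelFunctions.

Section Main.
Context {R : realType} {d : nat} {N : manifold R d}.
Variables (Ghat : tensor2 N) (G : R -> tensor2 N).
Variable mu : {sigma_finite_measure set (borel N) -> \bar R}.
Hypothesis cN : compact [set: N].
Hypothesis hGhat : is_riemannian Ghat.
Hypothesis hmu : is_riemannian_measure Ghat mu.
Hypothesis hG : is_cyl_metric 0 pi G.
Let I : set R := `]0, pi[.

Let inI (r : R) : 0 < r < pi -> I r.
Proof. by rewrite /I/= in_itv. Qed.

Let oI : open I. Proof. exact: itv_open. Qed.

Let radial_posdef p r : I r -> posdef (radial G p r).
Proof. by apply: (family_posdef 0 pi G hG); exact: chart_atP. Qed.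

Let radial_C1 p i j : C1_on I (fun s => radial G p s i j).
Proof. by apply: (family_C1 0 pi G hG); exact: chart_atP. Qed.

Let radial_C2 p i j : C1_on I (derive1 (fun s => radial G p s i j)).
Proof. by apply: (family_C2 0 pi G hG); exact: chart_atP. Qed.

Lemma radial_massE r : 0 < r < pi -> radial_mass mu sin Ghat G r =
  \int[mu]_(p in [set: borel N]) radial_flux (radial G p) r.
Proof.
move=> rI; apply: eq_Rintegral => p _.
have s0 : sin r != 0 :> R by rewrite gt_eqF// sin_gt0_pi.
have pH s : I s -> posdef (sin s ^+ 2 *: Ghat (chart_at p) p).
  rewrite /I/= in_itv/= => sI; apply: posdefZ.
    by rewrite exprn_gt0// sin_gt0_pi.
  by apply: riemannian_posdef => //; exact: chart_atP.
have := mxtrace_weinmx_warped _ pH _ (fun s _ => erefl) r (inI r rI).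
rewrite /radial_flux mulrBr => h; congr (_ - _).
by rewrite expr2 -mulrA [X in _ * X]h mulrCA mulrA mulrC mulrA.
Qed.

(** The constant metric is the member of the family at r = pi / 2.  The
    equation is solved in the chart selected at p and carried to the other charts
    by the tensor law. *)
Lemma excess_eq0_is_warped : (forall r p, 0 < r < pi -> excess (radial G p) r = 0) ->
  is_warped 0 pi sin G.
Proof.
move=> Q0; have pi2 := @pi2_in R.
have pi2' : 0 < (pi : R) / 2 < pi by move: pi2; rewrite /= in_itv.
exists (G (pi / 2)); first exact: hG.1.
move=> r c p rI cp; rewrite /warped.
have [tr _ _ _] := hG.1 r rI; have [tpi _ _ _] := hG.1 _ pi2'.
rewrite (tr c (chart_at p) p cp (chart_atP p)) (tpi c (chart_at p) p cp (chart_atP p)).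
rewrite -[G r (chart_at p) p]/(radial G p r).
rewrite (excess_eq0_warped (radial G p) (radial_posdef p) (radial_C1 p) _ r (inI r rI)).
  by rewrite -scalemxAr -scalemxAl.
by move=> s; rewrite /= in_itv/= => sI; exact: Q0.
Qed.

Lemma is_warped_excess_eq0 : is_warped 0 pi sin G ->
  forall r p, 0 < r < pi -> excess (radial G p) r = 0.
Proof.
move=> [S hS GS] r p rI.
apply: (excess_warped _ (radial_posdef p) (S (chart_at p) p)); last exact: inI.
by move=> s; rewrite /= in_itv/= => sI; rewrite /radial GS//; exact: chart_atP.
Qed.

(** Both families are warped by sin, so the relative norm of their
    difference at p is the same for all r; being arbitrarily small, it is zero. *)
Lemma asymptotic_warped_eq r0 : 0 <= r0 <= pi ->
  asymptotic_at 0 pi G (warped sin Ghat) r0 -> is_warped 0 pi sin G ->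
  eq_family 0 pi G (warped sin Ghat).
Proof.
move=> r0I asym [S hS GS].
have SE p : S (chart_at p) p = Ghat (chart_at p) p.
  have cp : cdom (chart (chart_at p)) p := chart_atP p.
  have pGhat := riemannian_posdef _ _ _ hGhat cp.
  apply/eqP; rewrite -subr_eq0; apply/eqP.
  apply: (tensor_norm_eq0 _ _ pGhat) => e e0.
  have [r rI /(_ p)] := within_itv_ex _ _ _ _ (@pi_gt0 R) r0I (asym e e0).
  rewrite /= GS// /warped -scalerBr tensor_norm_scale//.
  by rewrite exprn_gt0// sin_gt0_pi.
move=> r c p rI cp; rewrite GS// /warped; congr (_ *: _).
have [tS _ _ _] := hS; have [tH _ _ _] := hGhat.
by rewrite (tS c _ p cp (chart_atP p)) (tH c _ p cp (chart_atP p)) SE.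
Qed.

Variables (k m0 mpi : R).
Hypothesis kd : k = d%:R.
Hypothesis hm0 : radial_mass mu sin Ghat G r @[r --> 0^'+] --> m0.
Hypothesis hmpi : radial_mass mu sin Ghat G r @[r --> pi^'-] --> mpi.
Let vol := (lebesgue_measure \x mu)%E.
Let M := `]0, (pi : R)[ `*` [set: borel N].
Let F := fun z : R * borel N =>
  (radial_ricci 0 pi G z.1 z.2 - k) * sin z.1 ^+ 2.
Hypothesis intF : vol.-integrable M (EFin \o F).

Let u r p := radial_flux (radial G p) r.
Let Q r p := excess (radial G p) r.

Let cF (p : borel N) r : 0 < r < pi -> cont_at r (fun s => F (s, p)).
Proof.
move=> /inI rI.
have FP := @fun_field_continuous_at R _ _ _ (open_nbhs_nbhs (conj oI rI)).
apply: (ff_ext _ _ FP (fun s => (riccati (radial G p) s - k) * sin s ^+ 2)).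
  by move=> s sI; rewrite /F /= radial_ricciE.
apply: (ff_mul _ _ FP).
  apply: (ff_sub FP); last exact: (ff_cst _ _ FP).
  exact: (riccati_continuous _ oI (radial_posdef p) (radial_C1 p) (radial_C2 p)).
by apply: (ff_mul _ _ FP); exact: continuous_sin.
Qed.

Let cQ (p : borel N) r : 0 < r < pi -> cont_at r (fun s => Q s p).
Proof.
move=> /inI; exact: (excess_continuous _ oI (radial_posdef p) (radial_C1 p) (radial_C2 p)).
Qed.

Let Q_ge0 (p : borel N) r : 0 < r < pi -> 0 <= Q r p.
Proof. move=> /inI; exact: (excess_ge0 _ oI (radial_posdef p)). Qed.

Let du (p : borel N) r : 0 < r < pi ->
  is_derive r 1 (fun s => u s p) (F (r, p) + Q r p).
Proof.
move=> /inI rI; rewrite /F/= (radial_ricciE 0 pi G hG r p rI) kd.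
exact: (radial_flux_derive _ oI (radial_posdef p) (radial_C1 p) (radial_C2 p)).
Qed.

Let mu_u r : 0 < r < pi -> measurable_fun [set: borel N] (u r).
Proof.
move=> /inI rI; apply: borel_continuous_measurable.
exact: (radial_flux_continuous 0 pi G hG).
Qed.

Let bnd_u r : 0 < r < pi -> [bounded u r p | p in [set: borel N]].
Proof.
move=> /inI rI; apply: compact_continuous_bounded => //.
exact: (radial_flux_continuous 0 pi G hG).
Qed.

Let mufin : (mu [set: borel N] < +oo)%E.
Proof. exact: (riemannian_measure_finite Ghat hGhat mu hmu cN). Qed.

Let mass_lo : \int[mu]_(p in [set: borel N]) u r p @[r --> 0^'+] --> m0.
Proof.
apply: cvg_trans hm0; apply: near_eq_cvg; near=> r; rewrite radial_massE//.
by apply/andP; split; near: r; [exact: nbhs_right_gt|exact: nbhs_right_lt (@pi_gt0 R)].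
Unshelve. all: by end_near. Qed.

Let mass_hi : \int[mu]_(p in [set: borel N]) u r p @[r --> pi^'-] --> mpi.
Proof.
apply: cvg_trans hmpi; apply: near_eq_cvg; near=> r; rewrite radial_massE//.
by apply/andP; split; near: r; [exact: nbhs_left_gt (@pi_gt0 R)|exact: nbhs_left_lt].
Unshelve. all: by end_near. Qed.

Lemma mass_difference_ge : \int[vol]_(z in M) F z <= mpi - m0.
Proof.
exact: (defect_ge0 mu 0 pi u Q F (@pi_gt0 R) mufin cF cQ Q_ge0 du mu_u bnd_u intF
  m0 mpi mass_lo mass_hi).
Qed.

(** For the direct implication: if the excess at r is nonzero at p, it is
    nonzero on a neighbourhood of p, which has positive measure. *)
Lemma mass_eq_excess0 : mpi - m0 = \int[vol]_(z in M) F z <->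
  forall r p, 0 < r < pi -> excess (radial G p) r = 0.
Proof.
split => [eq_mass r p rI|Q0]; last first.
  exact: (defect_eq0 mu 0 pi u Q F (@pi_gt0 R) mufin cF cQ du mu_u bnd_u intF
    m0 mpi mass_lo mass_hi Q0).
have [r0 rr rpi rrr] := between_halves r pi rI.
have [A [mA A0 QA]] := defect_eq0_ae mu 0 pi u Q F (@pi_gt0 R) mufin cF cQ Q_ge0 du
  mu_u bnd_u intF m0 mpi mass_lo mass_hi eq_mass _ _ r0 rr rpi.
apply/eqP/contraT => Qrp.
pose U : set N := [set q | Q r q != 0].
have oU : open U.
  have /continuousP := radial_excess_continuous 0 pi G hG r (inI r rI).
  by move=> /(_ [set x | x != 0]); apply; exact: open_neq.
have := riemannian_measure_open_gt0 Ghat hGhat mu hmu U oU (ex_intro _ p Qrp).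
have UA : (U : set (borel N)) `<=` A.
  by move=> q Uq; apply: QA => /= /(_ r rrr) Qq; move: Uq; rewrite /U/= Qq eqxx.
rewrite lt_neqAle => /andP[/negP + _]; case; apply/eqP/esym.
by apply: subset_measure0 UA A0 => //; exact: borel_open.
Qed.

End Main.

Theorem corollary5p4 (R : realType) (n : nat) (hn : (2 <= n)%N)
  (N : manifold R n.-1) (hN : compact [set: N])
  (Ghat : tensor2 N) (hGhat : is_riemannian Ghat)
  (mu : {sigma_finite_measure set (borel N) -> \bar R})
  (hmu : is_riemannian_measure Ghat mu)
  (G : R -> tensor2 N) (hG : is_cyl_metric 0 pi G)
  (m0 mpi : R)
  (hm0 : radial_mass mu sin Ghat G r @[r --> 0^'+] --> m0)
  (hmpi : radial_mass mu sin Ghat G r @[r --> pi^'-] --> mpi) :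
  let vol := (lebesgue_measure \x mu)%E in
  let M := `]0, pi[ `*` [set: borel N] in
  let F := fun z : R * borel N =>
    (radial_ricci 0 pi G z.1 z.2 - (n%:R - 1)) * sin z.1 ^+ 2 in
  vol.-integrable M (EFin \o F) ->
  [/\ mpi - m0 >= \int[vol]_(z in M) F z,
      mpi - m0 = \int[vol]_(z in M) F z <-> is_warped 0 pi sin G &
      forall r0 : R, 0 <= r0 <= pi ->
        asymptotic_at 0 pi G (warped sin Ghat) r0 ->
        (mpi - m0 = \int[vol]_(z in M) F z <->
         eq_family 0 pi G (warped sin Ghat))].
Proof.
move=> vol M F intF.
have kd : n%:R - 1 = n.-1%:R :> R.
  by case: n hn {N hN Ghat hGhat mu hmu G hG hm0 hmpi vol M F intF} => // n _;
    rewrite -natr1 addrK.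
have eqW : mpi - m0 = \int[vol]_(z in M) F z <-> is_warped 0 pi sin G.
  rewrite (mass_eq_excess0 _ _ _ hN hGhat hmu hG _ _ _ kd hm0 hmpi intF).
  by split; [exact: excess_eq0_is_warped|exact: is_warped_excess_eq0].
split => //; first exact: (mass_difference_ge _ _ _ hN hGhat hmu hG _ _ _ kd hm0 hmpi intF).
move=> r0 r0I asym; rewrite eqW; split; first exact: asymptotic_warped_eq r0I asym.
by move=> GE; exists Ghat.
Qed.
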